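(* Let $X=\mathbb{R}^2\cup\{q\}$ with $q\notin\mathbb{R}^2$ be equipped with the metric $d_2$ given by $d_2(x,x')=\|x-x'\|$ and $d_2(q,x)=d_2(x,q)=\sqrt{1+\|x\|^2}$ for all $x,x'\in\mathbb{R}^2$ (and $d_2(q,q)=0$), where $\|\cdot\|$ is the Euclidean norm. Then the $2$-Wasserstein space $\mathcal{W}_2(\mathbb{R}^2\cup\{q\},d_2)$ is isometrically rigid. That is, for every isometry $\Phi$ of $\mathcal{W}_2(\mathbb{R}^2\cup\{q\},d_2)$ onto itself there is an isometry $\psi$ of $(\mathbb{R}^2\cup\{q\},d_2)$ onto itself such that $\Phi=\psi_{\#}$.
   Context: For a Polish metric space $(X,d)$ and $p\ge 1$, $\mathcal{W}_p(X,d)$ is the set of Borel probability measures $\mu$ on $X$ with $\int_X d^p(x_0,x)\,d\mu(x)<\infty$ for some (hence any) $x_0\in X$, equipped with the Wasserstein distance $$d_{\mathcal{W}_p}(\mu,\nu)=\inf_{\pi\in\Pi(\mu,\nu)}\left(\int_{X\times X}d^p(x,y)\,d\pi(x,y)\right)^{1/p},$$ where $\Pi(\mu,\nu)$ is the set of couplings of $\mu$ and $\nu$, i.e. Borel probability measures on $X\times X$ with first marginal $\mu$ and second marginal $\nu$. An isometry is a distance-preserving surjective map. For a measurable map $\psi:X\to X$, the push-forward is $\psi_{\#}(\mu)(A)=\mu(\psi^{-1}(A))$ for Borel $A\subset X$. Equivalently, $(\mathbb{R}^2\cup\{q\},d_2)$ is the subset $(\mathbb{R}^2\times\{0\})\cup\{(0,0,1)\}$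 of $\mathbb{R}^3$ with the Euclidean distance, with $q=(0,0,1)$. *)

(* Defs.v *)
From HB Require Import structures.
From mathcomp Require Import all_boot all_order all_algebra.
From mathcomp Require Import ring lra.
From mathcomp Require Import all_classical all_reals all_analysis.

Set Implicit Arguments.
Unset Strict Implicit.
Unset Printing Implicit Defensive.

Import Order.TTheory GRing.Theory Num.Theory.
Import numFieldNormedType.Exports.

Local Open Scope classical_set_scope.
Local Open Scope ring_scope.

(* The library's measurable types are pointed, hence the point. *)
#[short(type="pmetricType")]
HB.structure Definition PointedMetric (K : numDomainType) :=
  { M of Metric K M & Pointed M }.

Notation borel T := (g_sigma_algebraType (@open T)).

Section metric_isometry.
Context {R : realType} {X : pmetricType R}.

Definition is_isometry (psi : X -> X) :=
  (forall x y, mdist (psi x) (psi y) = mdist x y) /\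
  (forall y, exists x, psi x = y).

End metric_isometry.

Section wasserstein.
Context {R : realType}.
Variables (X : pmetricType R) (p : R).
Implicit Types mu nu : probability (borel X) R.

(* A library measure is a function on all sets, unconstrained outside the
   sigma-algebra, so measures are compared on Borel sets only. *)
Definition same_measure mu nu :=
  forall A : set (borel X), measurable A -> mu A = nu A.

Definition coupling mu nu : set (probability (borel (X * X)%type) R) :=
  [set pi | forall A : set (borel X), measurable A ->
     pi (fst @^-1` A) = mu A /\ pi (snd @^-1` A) = nu A].

Definition wasserstein_dist mu nu : \bar R :=
  ereal_inf [set poweR (\int[pi]_z (mdist z.1 z.2 `^ p)%:E) p^-1
            | pi in coupling mu nu].

Record wasserstein_space := WassersteinSpace {
  wmeasure :> probability (borel X) R ;
  _ : exists x0 : X, (\int[wmeasure]_x (mdist x0 x `^ p)%:E < +oo)%E }.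

Definition is_wasserstein_isometry
    (Phi : wasserstein_space -> wasserstein_space) :=
  (forall mu nu : wasserstein_space,
     wasserstein_dist (Phi mu) (Phi nu) = wasserstein_dist mu nu) /\
  (forall nu : wasserstein_space,
     exists mu : wasserstein_space, same_measure (Phi mu) nu).

Definition isometrically_rigid :=
  forall Phi : wasserstein_space -> wasserstein_space,
    is_wasserstein_isometry Phi ->
    exists psi : X -> X, is_isometry psi /\
      forall (mu : wasserstein_space) (A : set (borel X)), measurable A ->
        Phi mu A = pushforward mu (psi : borel X -> borel X) A.

End wasserstein.

Definition euclidean_norm {R : realType} {n : nat} (x : 'rV[R]_n) : R :=
  Num.sqrt (\sum_(i < n) x 0 i ^+ 2).

(* [None] is the extra point q. *)
Definition plane_with_point (R : realType) : Type := option 'rV[R]_2.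

Section plane_with_point.
Context {R : realType}.
Local Notation X := (plane_with_point R).
Implicit Types x y z : X.

Definition d2 x y : R :=
  match x, y with
  | Some u, Some v => euclidean_norm (u - v)
  | Some u, None | None, Some u => Num.sqrt (1 + euclidean_norm u ^+ 2)
  | None, None => 0
  end.

(* Coordinates of the embedding of the space in R^3 that sends q to (0,0,1). *)
Let c1 x : R := if x is Some u then u 0 0 else 0.
Let c2 x : R := if x is Some u then u 0 1 else 0.
Let c3 x : R := if x is Some u then 0 else 1.

Let norm3 (a b c : R) : R := Num.sqrt (a ^+ 2 + b ^+ 2 + c ^+ 2).

Let sum2 (u : 'rV[R]_2) : \sum_(i < 2) u 0 i ^+ 2 = u 0 0 ^+ 2 + u 0 1 ^+ 2.
Proof. by rewrite big_ord_recr big_ord1/=; congr (u 0 _ ^+ 2 + u 0 _ ^+ 2);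
  apply/val_inj. Qed.

Let d2E x y : d2 x y = norm3 (c1 x - c1 y) (c2 x - c2 y) (c3 x - c3 y).
Proof.
case: x y => [u|] [v|] /=; rewrite /norm3 /euclidean_norm ?sum2 ?mxE.
- by rewrite subrr expr0n/= addr0.
- rewrite sqr_sqrtr ?addr_ge0 ?sqr_ge0//; congr Num.sqrt; ring.
- rewrite sqr_sqrtr ?addr_ge0 ?sqr_ge0//; congr Num.sqrt; ring.
- by rewrite !subrr expr0n/= !addr0 sqrtr0.
Qed.

Let norm3_triangle a b c a' b' c' :
  norm3 (a + a') (b + b') (c + c') <= norm3 a b c + norm3 a' b' c'.
Proof.
have nn (u v w : R) : 0 <= u ^+ 2 + v ^+ 2 + w ^+ 2.
  by rewrite !addr_ge0 ?sqr_ge0.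
rewrite -ler_sqr ?nnegrE ?addr_ge0 ?sqrtr_ge0//.
rewrite sqrrD !sqr_sqrtr// -sqrtrM//.
set q := (X in Num.sqrt X).
have : a * a' + b * b' + c * c' <= Num.sqrt q.
  apply: le_trans (ler_norm _) _; rewrite -sqrtr_sqr ler_sqrt ?mulr_ge0//.
  rewrite -subr_ge0 /q.
  have -> : (a ^+ 2 + b ^+ 2 + c ^+ 2) * (a' ^+ 2 + b' ^+ 2 + c' ^+ 2)
      - (a * a' + b * b' + c * c') ^+ 2 = (a * b' - b * a') ^+ 2
      + (a * c' - c * a') ^+ 2 + (b * c' - c * b') ^+ 2 by ring.
  exact: nn.
move: (Num.sqrt q) => s; rewrite mulr2n; lra.
Qed.

Let d2xx x : d2 x x = 0.
Proof. by rewrite d2E !subrr /norm3 expr0n/= !addr0 sqrtr0. Qed.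

Let d2_positivity x y : d2 x y = 0 -> x = y.
Proof.
rewrite d2E => /eqP; rewrite sqrtr_eq0 => h.
have sq0 (a : R) : a ^+ 2 <= 0 -> a = 0.
  by move=> a0; apply/eqP; rewrite -sqrf_eq0 eq_le a0 sqr_ge0.
have := (sqr_ge0 (c1 x - c1 y), sqr_ge0 (c2 x - c2 y), sqr_ge0 (c3 x - c3 y)).
case=> -[h1 h2] h3.
have /sq0 e1 : (c1 x - c1 y) ^+ 2 <= 0 by lra.
have /sq0 e2 : (c2 x - c2 y) ^+ 2 <= 0 by lra.
have /sq0 e3 : (c3 x - c3 y) ^+ 2 <= 0 by lra.
case: x y e1 e2 e3 {h h1 h2 h3} => [u|] [v|] //=; [|by move=> _ _ ?; exfalso; lra..].
move=> e1 e2 _; congr Some; apply/rowP => i.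
by case/boolP: (i == 0) => [/eqP->|i0]; [lra|
  have -> : i = 1 by apply/val_inj; case: i i0 => -[|[]]]; lra.
Qed.

Let d2_sym x y : d2 x y = d2 y x.
Proof. by rewrite !d2E /norm3; congr Num.sqrt; ring. Qed.

Let d2_triangle y x z : d2 x z <= d2 x y + d2 y z.
Proof.
rewrite !d2E; apply: le_trans (norm3_triangle _ _ _ _ _ _).
by rewrite !addrA !subrK.
Qed.

HB.instance Definition _ := Choice.on X.
HB.instance Definition _ := isPointed.Build X None.
HB.instance Definition _ := isMetric.Build R X
  d2xx d2_positivity d2_sym d2_triangle.

End plane_with_point.

(* Main.v *)
(* Embed the space in R^3 with q as origin; the squared distance is then affine
   in the moments of a measure as soon as the other measure is a point mass.

   Only q has no midpoints: a midpoint of q and a planar point would lie at height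
   1/2.  So an isometry Phi of the Wasserstein space fixes the point mass at q.
   On a sphere of squared radius s >= 4 around it, the largest squared distance is
   4 (s - 1), attained exactly by antipodal planar point masses; this follows by
   testing with the product coupling.  Hence Phi maps far planar point masses to
   such, by an orthogonal map psi, and the distances to them show that Phi acts on
   means through psi and preserves the mass at q and the second moment.  In
   particular Phi acts as psi on measures carried by q and one planar point x.

   The distances from mu to these two-point measures are, by duality, the
   integrals of (<x, y> - s)^+ against mu, so they determine the law under mu of
   every linear form.  For a measure on a grid this determines the measure, using
   the two coordinates and one linear form of irrational slope.  So Phi is the
   push-forward by psi on grid measures, which are dense. *)
From HB Require Import structures.
Require Import Defs.
From mathcomp Require Import all_boot all_order all_algebra.
From mathcomp Require Import ring lra zify.
From mathcomp Require Import measurable_realfun.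
From mathcomp Require Import all_classical all_reals all_analysis.

Set Implicit Arguments.
Unset Strict Implicit.
Unset Printing Implicit Defensive.

Import Order.TTheory GRing.Theory Num.Theory.
Import numFieldNormedType.Exports.

Local Open Scope classical_set_scope.
Local Open Scope ring_scope.

(** * Integrals against a probability measure and sets of full measure *)

Section probability_integral.
Context d (T : measurableType d) (R : realType).
Implicit Types (P Q : {measure set T -> \bar R}) (f g : T -> R).

(** The complement of [S] is null, so both integrals may be restricted to [S]. *)
Lemma Rintegral_le_on (P : probability T R) (S : set T) f g :
  measurable S -> P S = 1%E ->
  P.-integrable setT (EFin \o f) -> P.-integrable setT (EFin \o g) ->
  (forall x, S x -> f x <= g x) ->
  \int[P]_x f x <= \int[P]_x g x.
Proof.
move=> mS PS fi gi fg.
have mSC : measurable (~` S) by exact: measurableC.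
have PSC : P (~` S) = 0%E.
  by rewrite probability_setC// PS subee.
have onS h : P.-integrable setT (EFin \o h) ->
    \int[P]_x h x = \int[P]_(x in S) h x.
  move=> hi; rewrite /Rintegral.
  by rewrite (negligible_integral mSC measurableT hi PSC) setTD setCK.
rewrite !onS//; apply: le_Rintegral => //.
- exact: (integrableS measurableT).
- exact: (integrableS measurableT).
Qed.

Lemma Rintegral_eq_on (P : probability T R) (S : set T) f g :
  measurable S -> P S = 1%E ->
  P.-integrable setT (EFin \o f) -> P.-integrable setT (EFin \o g) ->
  (forall x, S x -> f x = g x) ->
  \int[P]_x f x = \int[P]_x g x.
Proof.
move=> mS PS fi gi fg; apply/eqP; rewrite eq_le; apply/andP; split.
- by apply: (Rintegral_le_on mS) => // x /fg ->.
- by apply: (Rintegral_le_on mS) => // x /fg ->.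
Qed.

Lemma Rintegral_indic (P : probability T R) (A : set T) :
  measurable A -> \int[P]_x \1_A x = fine (P A).
Proof. by move=> mA; rewrite /Rintegral integral_indic// setIT. Qed.

Lemma integrable_EFinE (P : probability T R) f :
  P.-integrable setT (EFin \o f) ->
  (\int[P]_x (f x)%:E)%E = (\int[P]_x f x)%:E.
Proof. by move=> fi; rewrite /Rintegral fineK//; exact: integrable_fin_num. Qed.

Lemma integrable_addR (P : probability T R) f g :
  P.-integrable setT (EFin \o f) -> P.-integrable setT (EFin \o g) ->
  P.-integrable setT (EFin \o (fun x => f x + g x)).
Proof. by move=> fi gi; exact: (integrableD measurableT fi gi). Qed.

Lemma integrable_scaleR (P : probability T R) (k : R) f :
  P.-integrable setT (EFin \o f) ->
  P.-integrable setT (EFin \o (fun x => k * f x)).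
Proof. by move=> fi; exact: (integrableZl measurableT k fi). Qed.

Lemma integrable_cstR (P : probability T R) (k : R) :
  P.-integrable setT (EFin \o (fun _ => k)).
Proof. exact: finite_measure_integrable_cst. Qed.

Lemma ge0_integrable (P : probability T R) f :
  measurable_fun setT f -> (forall x, 0 <= f x) ->
  (\int[P]_x (f x)%:E < +oo)%E -> P.-integrable setT (EFin \o f).
Proof.
move=> mf f0 foo; apply/integrableP; split; first exact/measurable_EFinP.
by under eq_integral do rewrite /= ger0_norm//.
Qed.

Lemma probability_setI1 (P : probability T R) (A B : set T) :
  measurable A -> measurable B -> P B = 1%E -> P (A `&` B) = P A.
Proof.
move=> mA mB PB; have PBC : P (~` B) = 0%E by rewrite probability_setC// PB subee.
apply/eqP; rewrite eq_le; apply/andP; split.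
  by apply: le_measure; rewrite ?inE//; exact: measurableI.
apply: (@le_trans _ _ (P ((A `&` B) `|` ~` B))).
  apply: le_measure; rewrite ?inE//.
    by apply: measurableU; [exact: measurableI|exact: measurableC].
  by move=> x Ax; have [Bx|nBx] := pselect (B x); [left|right].
rewrite (le_trans (measureU2 _ _ _))//; [exact: measurableI|exact: measurableC|].
by rewrite [X in (_ + X <= _)%E]PBC adde0.
Qed.

Lemma Rintegral_eq0_on (P : probability T R) f :
  measurable_fun setT f -> (forall x, 0 <= f x) ->
  P.-integrable setT (EFin \o f) ->
  \int[P]_x f x <= 0 -> P [set x | f x = 0] = 1%E.
Proof.
move=> mf f0 fi If.
have If0 : (\int[P]_x `|(f x)%:E| = 0)%E.
  under eq_integral do rewrite /= ger0_norm//.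
  rewrite integrable_EFinE//; congr EFin.
  by apply/eqP; rewrite eq_le If/= Rintegral_ge0.
have /measurable_EFinP mfe := mf.
have [N [mN PN sN]] := (ae_eq_integral_abs P measurableT mfe).1 If0.
have mZ : measurable [set x | f x = 0].
  have -> : [set x | f x = 0] = f @^-1` [set 0] by [].
  by rewrite -[_ @^-1` _]setTI; exact: mf.
have P0 : P (~` [set x | f x = 0]) = 0%E.
  apply/eqP; rewrite eq_le measure_ge0 andbT -PN le_measure ?inE//.
    exact: measurableC.
  by move=> x /= fx; apply: sN => /= /(_ I) [] /fx.
by rewrite -[X in P X]setCK probability_setC ?P0 ?sube0//; exact: measurableC.
Qed.

End probability_integral.

(** * Image measures and change of variables *)

Section pushforward_integral.
Context d d' (T : measurableType d) (T' : measurableType d') (R : realType).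
Variables (P : probability T R) (phi : T -> T').
Hypothesis mphi : measurable_fun setT phi.

Let mphi_mfun : {mfun T >-> T'} :=
  HB.pack phi (isMeasurableFun.Build _ _ _ _ phi mphi).

Definition push_prob : probability T' R := distribution P mphi_mfun.

Lemma push_probE A : push_prob A = P (phi @^-1` A).
Proof. by []. Qed.

Lemma integral_push_prob (f : T' -> R) : measurable_fun setT f ->
  (forall x, 0 <= f x) ->
  (\int[push_prob]_x (f x)%:E = \int[P]_x (f (phi x))%:E)%E.
Proof.
move=> mf f0; rewrite (ge0_integral_pushforward mphi)//.
- exact/measurable_EFinP.
- by move=> y _; rewrite lee_fin.
Qed.

Lemma integrable_push_prob (f : T' -> R) : measurable_fun setT f ->
  P.-integrable setT (EFin \o (f \o phi)) ->
  push_prob.-integrable setT (EFin \o f).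
Proof.
by move=> mf fi; apply: (integrable_pushforward mphi) => //; exact/measurable_EFinP.
Qed.

Lemma Rintegral_push_prob (f : T' -> R) : measurable_fun setT f ->
  P.-integrable setT (EFin \o (f \o phi)) ->
  \int[push_prob]_x f x = \int[P]_x f (phi x).
Proof.
move=> mf fi; congr fine.
by rewrite (integral_pushforward mphi)//; exact/measurable_EFinP.
Qed.

End pushforward_integral.

(** * Borel maps and Borel sets from open sets *)

Section borel_measurability.
Context {R : realType}.

Lemma borel_measurability d (T : measurableType d) (Z : pmetricType R)
    (f : T -> Z) :
  (forall U, open U -> measurable (f @^-1` U)) ->
  measurable_fun setT (f : T -> borel Z).
Proof.
move=> mf; apply: (@measurability _ _ T (borel Z) setT f (@open Z) erefl).
by move=> _ [U oU <-]; rewrite setTI; exact: mf.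
Qed.

Lemma real_measurability d (T : measurableType d) (f : T -> R) :
  (forall U, open U -> measurable (f @^-1` U)) -> measurable_fun setT f.
Proof.
move=> mf; apply: (measurability _ (RGenOpens.measurableE R)).
by move=> _ [_ [a [b ->]] <-]; rewrite setTI; apply: mf; exact: interval_open.
Qed.

Lemma open_borel (Y : pmetricType R) (U : set Y) :
  open U -> measurable (U : set (borel Y)).
Proof. exact: sub_sigma_algebra. Qed.

Lemma closed_borel (Y : pmetricType R) (U : set Y) :
  closed U -> measurable (U : set (borel Y)).
Proof.
move=> cU; rewrite -[U]setCK; apply: measurableC.
by apply: open_borel; exact: closed_openC.
Qed.

End borel_measurability.

(** * Continuity and measurability of the distance *)

Section metric_borel.
Context {R : realType} {X : pmetricType R}.

Lemma mdist_continuous : continuous (fun z : X * X => mdist z.1 z.2 : R).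
Proof.
move=> z; apply/cvgrPdist_lt => e e0.
have e20 : 0 < e / 2 by rewrite divr_gt0.
near=> t.
have t1 : mdist z.1 t.1 < e / 2.
  near: t; apply: (metricType_numDomainType.cvgr_dist_lt _ e20).
  exact: cvg_fst.
have t2 : mdist z.2 t.2 < e / 2.
  near: t; apply: (metricType_numDomainType.cvgr_dist_lt _ e20).
  exact: cvg_snd.
have h1 := metric_triangle z.1 t.1 z.2.
have h2 := metric_triangle t.1 t.2 z.2.
have h3 := metric_triangle t.1 z.1 t.2.
have h4 := metric_triangle z.1 z.2 t.2.
have h5 : mdist t.2 z.2 = mdist z.2 t.2 by exact: metric_sym.
have h6 : mdist t.1 z.1 = mdist z.1 t.1 by exact: metric_sym.
rewrite ltr_norml; apply/andP; split; lra.
Unshelve. all: by end_near. Qed.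

Lemma measurable_mdist :
  measurable_fun setT (fun z : borel (X * X)%type => mdist z.1 z.2 : R).
Proof.
apply: real_measurability => U oU; apply: sub_sigma_algebra.
by move/continuousP : mdist_continuous; exact.
Qed.

Lemma measurable_fst_borel :
  measurable_fun setT (fst : borel (X * X)%type -> borel X).
Proof.
apply: borel_measurability => U oU; apply: sub_sigma_algebra.
have /continuousP : continuous (fst : X * X -> X) by move=> z; exact: cvg_fst.
exact.
Qed.

Lemma measurable_snd_borel :
  measurable_fun setT (snd : borel (X * X)%type -> borel X).
Proof.
apply: borel_measurability => U oU; apply: sub_sigma_algebra.
have /continuousP : continuous (snd : X * X -> X) by move=> z; exact: cvg_snd.
exact.
Qed.

Lemma measurable_lipschitz (f : X -> R) :
  (forall x y, `|f x - f y| <= mdist x y) ->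
  measurable_fun setT (f : borel X -> R).
Proof.
move=> lf; apply: real_measurability => U oU; apply: open_borel.
suff /continuousP : continuous f by exact.
move=> x; apply/cvgrPdist_lt => e e0; near=> y.
apply: le_lt_trans (lf _ _) _.
near: y; apply: (metricType_numDomainType.cvgr_dist_lt _ e0); exact: cvg_id.
Unshelve. all: by end_near. Qed.

Lemma measurable_mdistr (x : X) :
  measurable_fun setT (fun y : borel X => mdist x y : R).
Proof.
apply: measurable_lipschitz => y z; rewrite ler_norml.
have := metric_triangle x z y; have := metric_triangle x y z.
by rewrite (metric_sym z y) => *; apply/andP; split; lra.
Qed.

Lemma closed_set1_metric (x : X) : closed [set x].
Proof.
exact: (accessible_closed_set1 (hausdorff_accessible (@metric_hausdorff _ X))).
Qed.

Lemma measurable_set1_borel (x : X) : measurable ([set x] : set (borel X)).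
Proof. by apply: (@closed_borel R X); exact: closed_set1_metric. Qed.

End metric_borel.

(** * Quadratic transport cost, couplings and weak duality *)

Section transport.
Context {R : realType} {X : pmetricType R}.
Implicit Types mu nu rho : probability (borel X) R.

(** The square of the Wasserstein distance of exponent 2. Without the roots, costs are integrals of
    polynomials in the coordinates. *)
Definition transport_cost mu nu : \bar R :=
  ereal_inf [set (\int[pi]_z (mdist z.1 z.2 ^+ 2)%:E)%E | pi in coupling mu nu].

Lemma transport_cost_ge0 mu nu : (0 <= transport_cost mu nu)%E.
Proof.
apply: le_ereal_inf_tmp => _ [pi _ <-].
by apply: integral_ge0 => z _; rewrite lee_fin sqr_ge0.
Qed.

Let poweR_le (r : R) (x y : \bar R) : 0 <= r -> (0 <= x)%E -> (0 <= y)%E ->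
  (x <= y)%E -> (poweR x r <= poweR y r)%E.
Proof.
by move=> r0 x0 y0; apply: gt0_ler_poweR => //; rewrite in_itv/= ?x0 ?y0 leey.
Qed.

(** Square and square root are monotone on the extended half-line, hence each passes through the
    infimum in one direction. *)
Lemma wasserstein_dist_sqr mu nu :
  (poweR (wasserstein_dist 2 mu nu) 2 = transport_cost mu nu)%E.
Proof.
have half2 : (2^-1 * 2 = 1 :> R)%R by rewrite mulVf.
have pE (pi : probability (borel (X * X)%type) R) :
    (\int[pi]_z (mdist z.1 z.2 `^ 2)%:E = \int[pi]_z (mdist z.1 z.2 ^+ 2)%:E)%E.
  by apply: eq_integral => z _; rewrite powR_mulrn ?mdist_ge0.
have I0 (pi : probability (borel (X * X)%type) R) :
    (0 <= \int[pi]_z (mdist z.1 z.2 ^+ 2)%:E)%E.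
  by apply: integral_ge0 => z _; rewrite lee_fin sqr_ge0.
have W0 : (0 <= wasserstein_dist 2 mu nu)%E.
  by apply: le_ereal_inf_tmp => _ [pi _ <-]; exact: poweR_ge0.
have C0 := transport_cost_ge0 mu nu.
apply/eqP; rewrite eq_le; apply/andP; split.
  apply: le_ereal_inf_tmp => _ [pi cpi <-].
  have : (wasserstein_dist 2 mu nu <=
      poweR (\int[pi]_z (mdist z.1 z.2 ^+ 2)%:E) 2^-1)%E.
    by apply: ereal_inf_lbound; exists pi => //; rewrite pE.
  move=> /(poweR_le (ler0n _ 2) W0 (poweR_ge0 _ _)).
  by rewrite -poweRrM half2 poweRe1.
have : (poweR (transport_cost mu nu) 2^-1 <= wasserstein_dist 2 mu nu)%E.
  apply: le_ereal_inf_tmp => _ [pi cpi <-]; rewrite pE.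
  apply: poweR_le; rewrite ?invr_ge0 ?ler0n//.
  by apply: ereal_inf_lbound; exists pi.
move=> /(poweR_le (ler0n _ 2) (poweR_ge0 _ _) W0).
by rewrite -poweRrM half2 poweRe1.
Qed.

Lemma eq_transport_cost mu nu mu' nu' :
  wasserstein_dist 2 mu nu = wasserstein_dist 2 mu' nu' ->
  transport_cost mu nu = transport_cost mu' nu'.
Proof. by rewrite -!wasserstein_dist_sqr => ->. Qed.

Lemma transport_cost_same_measurer mu nu nu' : same_measure nu nu' ->
  transport_cost mu nu = transport_cost mu nu'.
Proof.
move=> h; congr ereal_inf; apply/seteqP; split=> _ [pi cpi <-]; exists pi => // A mA.
  by case: (cpi _ mA) => -> ->; rewrite h.
by case: (cpi _ mA) => -> ->; rewrite h.
Qed.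

Lemma Rintegral_same_measure mu nu (f : X -> R) :
  same_measure mu nu -> \int[mu]_x f x = \int[nu]_x f x.
Proof.
by move=> h; congr fine; apply: eq_measure_integral => A mA _; exact: h.
Qed.

Lemma transport_cost_le mu nu (pi : probability (borel (X * X)%type) R) :
  coupling mu nu pi ->
  (transport_cost mu nu <= \int[pi]_z (mdist z.1 z.2 ^+ 2)%:E)%E.
Proof. by move=> cpi; apply: ereal_inf_lbound; exists pi. Qed.

Section coupling_marginals.
Variables (mu nu : probability (borel X) R).
Variable pi : probability (borel (X * X)%type) R.
Hypothesis cpi : coupling mu nu pi.
Variable f : X -> R.
Hypothesis mf : measurable_fun setT (f : borel X -> R).

Lemma integrable_coupling_fst : mu.-integrable setT (EFin \o f) ->
  pi.-integrable setT (EFin \o (f \o fst)).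
Proof.
move=> /integrableP[_ foo]; apply/integrableP; split.
  apply/measurable_EFinP.
  by have := measurableT_comp mf measurable_fst_borel; exact.
apply: le_lt_trans foo.
rewrite -(integral_push_prob pi measurable_fst_borel (f := fun x => `|f x|))//; last first.
  exact: measurableT_comp.
rewrite le_eqVlt; apply/orP; left; apply/eqP.
apply: eq_measure_integral => A mA _.
exact: (cpi mA).1.
Qed.

Lemma integrable_coupling_snd : nu.-integrable setT (EFin \o f) ->
  pi.-integrable setT (EFin \o (f \o snd)).
Proof.
move=> /integrableP[_ foo]; apply/integrableP; split.
  apply/measurable_EFinP.
  by have := measurableT_comp mf measurable_snd_borel; exact.
apply: le_lt_trans foo.
rewrite -(integral_push_prob pi measurable_snd_borel (f := fun x => `|f x|))//; last first.
  exact: measurableT_comp.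
rewrite le_eqVlt; apply/orP; left; apply/eqP.
apply: eq_measure_integral => A mA _.
exact: (cpi mA).2.
Qed.

Lemma Rintegral_coupling_fst : mu.-integrable setT (EFin \o f) ->
  \int[pi]_z f z.1 = \int[mu]_x f x.
Proof.
move=> fi; rewrite -(Rintegral_push_prob measurable_fst_borel)//; last first.
  exact: integrable_coupling_fst.
congr fine; apply: eq_measure_integral => A mA _.
exact: (cpi mA).1.
Qed.

Lemma Rintegral_coupling_snd : nu.-integrable setT (EFin \o f) ->
  \int[pi]_z f z.2 = \int[nu]_x f x.
Proof.
move=> fi; rewrite -(Rintegral_push_prob measurable_snd_borel)//; last first.
  exact: integrable_coupling_snd.
congr fine; apply: eq_measure_integral => A mA _.
exact: (cpi mA).2.
Qed.

End coupling_marginals.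

(** Kantorovich's weak duality: integrate the pointwise inequality against an arbitrary coupling. A
    coupling gives full mass to the product of [S1] and [S2], so the inequality is asked there
    only. *)
Lemma weak_duality mu nu (phi psi : X -> R) (S1 S2 : set X) :
  measurable (S1 : set (borel X)) -> mu S1 = 1%E ->
  measurable (S2 : set (borel X)) -> nu S2 = 1%E ->
  measurable_fun setT (phi : borel X -> R) -> mu.-integrable setT (EFin \o phi) ->
  measurable_fun setT (psi : borel X -> R) -> nu.-integrable setT (EFin \o psi) ->
  (forall y z, S1 y -> S2 z -> phi y + psi z <= mdist y z ^+ 2) ->
  ((\int[mu]_y phi y + \int[nu]_z psi z)%:E <= transport_cost mu nu)%E.
Proof.
move=> mS1 muS1 mS2 nuS2 mphi phii mpsi psii ineq.
apply: le_ereal_inf_tmp => _ [pi cpi <-].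
have mc : measurable_fun setT (fun z : borel (X * X)%type => mdist z.1 z.2 ^+ 2 : R).
  exact: measurable_funX measurable_mdist.
have c0 (z : borel (X * X)%type) : 0 <= mdist z.1 z.2 ^+ 2 :> R by exact: sqr_ge0.
have [coo|] := ltP (\int[pi]_z (mdist z.1 z.2 ^+ 2)%:E)%E +oo%E; last first.
  by move=> /(le_trans _); apply; rewrite leey.
have ci := ge0_integrable mc c0 coo.
rewrite (integrable_EFinE ci) lee_fin.
have i1 := integrable_coupling_fst cpi mphi phii.
have i2 := integrable_coupling_snd cpi mpsi psii.
rewrite -(Rintegral_coupling_fst cpi mphi phii).
rewrite -(Rintegral_coupling_snd cpi mpsi psii) -RintegralD//.
have mP1 : measurable ((fst @^-1` S1) : set (borel (X * X)%type)).
  by rewrite -[_ @^-1` _]setTI; exact: measurable_fst_borel.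
have mP2 : measurable ((snd @^-1` S2) : set (borel (X * X)%type)).
  by rewrite -[_ @^-1` _]setTI; exact: measurable_snd_borel.
apply: (Rintegral_le_on (measurableI _ _ mP1 mP2)) => //.
- have := (cpi _ mS1).1; rewrite muS1 => p1.
  have := (cpi _ mS2).2; rewrite nuS2 => p2.
  by rewrite probability_setI1.
- exact: (integrableD measurableT i1 i2).
- by move=> [y z] [/= Sy Sz]; exact: ineq.
Qed.

End transport.

(** * Borel measurability in separable metric spaces *)

Section separable_metric.
Context {R : realType} {X : pmetricType R} (I : countType) (D : I -> X).
Hypothesis dense_D : forall (x : X) (e : R), 0 < e -> exists i, mdist (D i) x < e.

Lemma invS_lt (e : R) : 0 < e -> exists n : nat, n.+1%:R^-1 < e.
Proof.
move=> e0; exists (Num.truncn e^-1); rewrite invf_plt ?posrE//.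
exact: truncnS_gt.
Qed.

(** Balls with centres in [D] and radii [1 / (n + 1)]: countably many, and a base of the
    topology. *)
Let B (p : I * nat) := [set y | mdist (D p.1) y < p.2.+1%:R^-1 :> R].

Let B_small (x : X) (e : R) : 0 < e ->
  exists n, forall y, exists p, [/\ p.2 = n, B p y & B p `<=` [set z | mdist y z < e]].
Proof.
move=> e0; have [n ne] : exists n : nat, n.+1%:R^-1 < e / 2 :> R.
  by apply: invS_lt; rewrite divr_gt0.
exists n => y; have [i iy] := @dense_D y n.+1%:R^-1 (ltac:(by rewrite invr_gt0)).
exists (i, n); split => // z; rewrite /B/= => iz.
rewrite (le_lt_trans (metric_triangle y (D i) z))// (metric_sym y).
by rewrite [ltRHS]splitr ltrD// (lt_trans _ ne).
Qed.

Let mB d (T : measurableType d) (f : T -> X) p :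
  (forall x, measurable_fun setT (fun t => mdist x (f t))) ->
  measurable (f @^-1` B p).
Proof.
move=> mf; have -> : f @^-1` B p =
    (fun t => mdist (D p.1) (f t)) @^-1` `]-oo, p.2.+1%:R^-1[%classic.
  by apply/seteqP; split=> t; rewrite /B/= in_itv.
by rewrite -[_ @^-1` _]setTI; apply: mf.
Qed.

(** Every open set is a countable union of the balls [B], and the preimage of a ball is a sublevel
    set of a distance function. *)
Lemma separable_borel_measurable d (T : measurableType d) (f : T -> X) :
  (forall x, measurable_fun setT (fun t => mdist x (f t))) ->
  measurable_fun setT (f : T -> borel X).
Proof.
move=> mf; apply: borel_measurability => U oU.
have -> : f @^-1` U =
    \bigcup_p (if `[< B p `<=` U >] then f @^-1` B p else set0).
  apply/seteqP; split=> [t Ut|t [p _]]; last by case: asboolP => // s /s.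
  have /nbhs_ballP[e /= e0 eU] : nbhs (f t) U by exact: open_nbhs_nbhs.
  have [n /(_ (f t))[p [_ pt ps]]] := @B_small (f t) _ e0.
  exists p => //; case: asboolP => // -[] z /ps.
  by have := eU z; rewrite ballEmdist.
apply: countable_bigcupT_measurable => // p.
by case: asboolP => // _; exact: mB.
Qed.

(** An open set of the product is a countable union of products of balls. This lets graphs and
    product measures define couplings, which live on the Borel sets of the product space rather than
    on the product sigma-algebra. *)
Lemma separable_pair_measurable d (T : measurableType d) (f g : T -> X) :
  (forall x, measurable_fun setT (fun t => mdist x (f t))) ->
  (forall x, measurable_fun setT (fun t => mdist x (g t))) ->
  measurable_fun setT ((fun t => (f t, g t)) : T -> borel (X * X)%type).
Proof.
move=> mf mg.
apply: (@measurability _ _ T (borel (X * X)%type) setT _ (@open (X * X)%type) erefl).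
move=> _ [U oU <-]; rewrite setTI.
pose ok (q : (I * nat) * (I * nat)) := `[< B q.1 `*` B q.2 `<=` U >].
have -> : (fun t => (f t, g t)) @^-1` U =
    \bigcup_q (if ok q then f @^-1` B q.1 `&` g @^-1` B q.2 else set0).
  apply/seteqP; split=> [t Ut|t [q _]]; last first.
    rewrite /ok; case: asboolP => // s [q1 q2]; exact: (s (f t, g t)).
  have /nbhs_ballP[e /= e0 eU] : nbhs (f t, g t) U by exact: open_nbhs_nbhs.
  have [n /[dup] /(_ (f t))[p [_ pt ps]] /(_ (g t))[q [_ qt qs]]] :=
    @B_small (f t) _ e0.
  exists (p, q) => //; rewrite /ok; case: asboolP => // -[] [a b] [/= /ps fa /qs gb].
  by apply: eU; split; rewrite ballEmdist.
apply: countable_bigcupT_measurable => // q.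
by rewrite /ok; case: asboolP => // _; apply: measurableI; exact: mB.
Qed.

End separable_metric.

(** * The space as a subset of three-dimensional Euclidean space *)

Section plane_coordinates.
Context {R : realType}.
Local Notation X := (plane_with_point R).
Implicit Types x y z : X.

(* Coordinates of the embedding in R^3, translated so that q is the origin. *)
Definition ca x : R := if x is Some u then u 0 0 else 0.
Definition cb x : R := if x is Some u then u 0 1 else 0.
Definition cc x : R := if x is Some u then 1 else 0.
Definition cq x : R := ca x ^+ 2 + cb x ^+ 2.

Definition pt (a b : R) : 'rV[R]_2 := \row_(i < 2) (if i == 0 then a else b).

Lemma ca_pt a b : ca (Some (pt a b)) = a.
Proof. by rewrite /= mxE. Qed.

Lemma cb_pt a b : cb (Some (pt a b)) = b.
Proof. by rewrite /= mxE. Qed.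

Lemma pt_eta u : pt (ca (Some u)) (cb (Some u)) = u.
Proof.
apply/rowP => i; rewrite mxE/=; case: eqP => [->//|/eqP i0].
by congr (u 0 _); apply/val_inj; case: i i0 => -[|[]].
Qed.

Lemma plane_inj x y : ca x = ca y -> cb x = cb y -> cc x = cc y -> x = y.
Proof.
case: x y => [u|] [v|]//; last 2 first.
- by move=> _ _ /eqP; rewrite oner_eq0.
- by move=> _ _ /eqP; rewrite eq_sym oner_eq0.
by move=> auv buv _; rewrite -(pt_eta u) -(pt_eta v) auv buv.
Qed.

Lemma ccP x : cc x = 0 /\ ca x = 0 /\ cb x = 0 \/ cc x = 1.
Proof. by case: x => [u|] /=; [right|left]. Qed.

Lemma mdist_sqr x y : mdist x y ^+ 2 =
  (ca x - ca y) ^+ 2 + (cb x - cb y) ^+ 2 + (cc x - cc y) ^+ 2 :> R.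
Proof.
have n2 (u : 'rV[R]_2) : euclidean_norm u ^+ 2 = u 0 0 ^+ 2 + u 0 1 ^+ 2 :> R.
  rewrite /euclidean_norm big_ord_recr big_ord1/= sqr_sqrtr ?addr_ge0 ?sqr_ge0//.
  by congr (u 0 _ ^+ 2 + u 0 _ ^+ 2); apply/val_inj.
have -> : mdist x y = d2 x y by [].
case: x y => [u|] [v|]; rewrite /= ?n2.
- by rewrite !mxE subrr expr0n/= addr0.
- by rewrite sqr_sqrtr ?addr_ge0 ?sqr_ge0// !subr0 expr1n addrC.
- by rewrite sqr_sqrtr ?addr_ge0 ?sqr_ge0//; ring.
- by rewrite expr0n/= !subrr expr0n/= !addr0.
Qed.

Let le_mdist (t : R) x y : t ^+ 2 <= mdist x y ^+ 2 -> `|t| <= mdist x y.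
Proof.
by move=> h; rewrite -ler_sqr ?nnegrE ?mdist_ge0// real_normK// num_real.
Qed.

Lemma measurable_ca : measurable_fun setT (ca : borel X -> R).
Proof.
by apply: measurable_lipschitz => x y; apply: le_mdist; rewrite mdist_sqr -addrA
  lerDl addr_ge0 ?sqr_ge0.
Qed.

Lemma measurable_cb : measurable_fun setT (cb : borel X -> R).
Proof.
by apply: measurable_lipschitz => x y; apply: le_mdist; rewrite mdist_sqr addrAC
  lerDr addr_ge0 ?sqr_ge0.
Qed.

Lemma measurable_cc : measurable_fun setT (cc : borel X -> R).
Proof.
by apply: measurable_lipschitz => x y; apply: le_mdist; rewrite mdist_sqr
  lerDr addr_ge0 ?sqr_ge0.
Qed.

Lemma measurable_cq : measurable_fun setT (cq : borel X -> R).
Proof.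
by apply: measurable_funD; apply: measurable_funX;
  [exact: measurable_ca|exact: measurable_cb].
Qed.

Let dense_points (o : option (rat * rat)) : X :=
  if o is Some p then Some (pt (ratr p.1) (ratr p.2)) else None.

Let dense_pointsP x (e : R) : 0 < e -> exists o, mdist (dense_points o) x < e.
Proof.
move=> e0; case: x => [u|]; last first.
  by exists None; rewrite mdistxx.
have [p] := @rat_in_itvoo R (u 0 0 - e / 2) (u 0 0 + e / 2) (ltac:(lra)).
rewrite in_itv/= => /andP[p1 p2].
have [r] := @rat_in_itvoo R (u 0 1 - e / 2) (u 0 1 + e / 2) (ltac:(lra)).
rewrite in_itv/= => /andP[r1 r2].
exists (Some (p, r)); rewrite -ltr_sqr ?nnegrE ?mdist_ge0// ?(ltW e0)//.
rewrite mdist_sqr /= !mxE/=; nra.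
Qed.

Let measurable_mdist_coord d (T : measurableType d) (f : T -> X) x :
  measurable_fun setT (ca \o f) -> measurable_fun setT (cb \o f) ->
  measurable_fun setT (cc \o f) ->
  measurable_fun setT (fun t => mdist x (f t)).
Proof.
move=> ma mb mc.
have -> : (fun t => mdist x (f t)) = (fun t => Num.sqrt ((ca x - ca (f t)) ^+ 2 +
    (cb x - cb (f t)) ^+ 2 + (cc x - cc (f t)) ^+ 2)).
  by apply/funext => t; rewrite -mdist_sqr sqrtr_sqr ger0_norm// mdist_ge0.
have msqrt : measurable_fun setT (@Num.sqrt R).
  by apply: continuous_measurable_fun => r; exact: sqrt_continuous.
apply: (measurableT_comp msqrt).
by do !apply: measurable_funD; apply: measurable_funX; apply: measurable_funB.
Qed.

Lemma measurable_to_plane d (T : measurableType d) (f : T -> X) :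
  measurable_fun setT (ca \o f) -> measurable_fun setT (cb \o f) ->
  measurable_fun setT (cc \o f) -> measurable_fun setT (f : T -> borel X).
Proof.
move=> ma mb mc; apply: (separable_borel_measurable dense_pointsP) => x.
exact: measurable_mdist_coord.
Qed.

Lemma measurable_to_plane_pair d (T : measurableType d) (f g : T -> borel X) :
  measurable_fun setT f -> measurable_fun setT g ->
  measurable_fun setT ((fun t => (f t, g t)) : T -> borel (X * X)%type).
Proof.
move=> mf mg; apply: (separable_pair_measurable dense_pointsP) => x.
- by have := measurableT_comp (measurable_mdistr x) mf; exact.
- by have := measurableT_comp (measurable_mdistr x) mg; exact.
Qed.

End plane_coordinates.

(** * First and second moments; swapped, graph and product couplings *)

Section moments.
Context {R : realType}.
Local Notation X := (plane_with_point R).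
Implicit Types (mu nu : probability (borel X) R) (x y z : X).

(** Equivalent to a finite second moment around q: the squared distance to q is [cq + cc], with [cc]
    bounded. *)
Definition finite_moment mu := mu.-integrable setT (EFin \o (cq : borel X -> R)).

Definition mean_a mu : R := \int[mu]_x ca x.
Definition mean_b mu : R := \int[mu]_x cb x.
Definition mean_c mu : R := \int[mu]_x cc x.
Definition mean_q mu : R := \int[mu]_x cq x.

(** Squared distances to a fixed point have this form, so their integrals depend on four moments
    only. *)
Definition quad (k0 k1 k2 k3 k4 : R) x :=
  k0 + k1 * ca x + k2 * cb x + k3 * cc x + k4 * cq x.

Lemma measurable_quad k0 k1 k2 k3 k4 :
  measurable_fun setT (quad k0 k1 k2 k3 k4 : borel X -> R).
Proof.
rewrite /quad; do !apply: measurable_funD => //; apply: measurable_funM => //.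
- exact: measurable_ca.
- exact: measurable_cb.
- exact: measurable_cc.
- exact: measurable_cq.
Qed.

Lemma cq_ge0 x : 0 <= cq x.
Proof. by rewrite addr_ge0 ?sqr_ge0. Qed.

Lemma cc_ge0 x : 0 <= cc x.
Proof. by case: x => [u|] /=. Qed.

Section finite_moment_integrals.
Variable mu : probability (borel X) R.
Hypothesis mu2 : finite_moment mu.

Lemma integrable_quad_bound (f : X -> R) (k : R) :
  measurable_fun setT (f : borel X -> R) ->
  (forall x, `|f x| <= k * (1 + cq x)) ->
  mu.-integrable setT (EFin \o (f : borel X -> R)).
Proof.
move=> mf fk.
have gi : mu.-integrable setT (EFin \o (fun x : borel X => k * (1 + cq x))).
  by apply/integrable_scaleR/integrable_addR; [exact: integrable_cstR|exact: mu2].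
apply: le_integrable gi => //; first exact/measurable_EFinP.
by move=> x _; rewrite /= lee_fin (le_trans (fk x))// ler_norm.
Qed.

Lemma integrable_ca : mu.-integrable setT (EFin \o (ca : borel X -> R)).
Proof.
apply: (@integrable_quad_bound _ 1); first exact: measurable_ca.
by move=> x; rewrite /cq ler_norml mul1r; apply/andP; split; nra.
Qed.

Lemma integrable_cb : mu.-integrable setT (EFin \o (cb : borel X -> R)).
Proof.
apply: (@integrable_quad_bound _ 1); first exact: measurable_cb.
by move=> x; rewrite /cq ler_norml mul1r; apply/andP; split; nra.
Qed.

Lemma integrable_cc : mu.-integrable setT (EFin \o (cc : borel X -> R)).
Proof.
apply: (@integrable_quad_bound _ 1); first exact: measurable_cc.
move=> x; rewrite mul1r; have := cq_ge0 x.
by case: x => [u|] /= h; rewrite ?normr1 ?normr0; lra.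
Qed.

Lemma integrable_quad k0 k1 k2 k3 k4 :
  mu.-integrable setT (EFin \o (quad k0 k1 k2 k3 k4 : borel X -> R)).
Proof.
pose K := `|k0| + `|k1| + `|k2| + `|k3| + `|k4|.
apply: (@integrable_quad_bound _ K); first exact: measurable_quad.
move=> x; have c0 := cq_ge0 x.
have ha : `|ca x| <= 1 + cq x by rewrite /cq ler_norml; apply/andP; split; nra.
have hb : `|cb x| <= 1 + cq x by rewrite /cq ler_norml; apply/andP; split; nra.
have hc : `|cc x| <= 1 + cq x.
  by case: (x) c0 => [u|] /= h; rewrite ?normr1 ?normr0; lra.
have hq : `|cq x| <= 1 + cq x by rewrite ger0_norm//; lra.
rewrite /quad /K !mulrDl.
do 4! (apply: le_trans (ler_normD _ _) _; apply: lerD;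
  last by rewrite normrM ler_wpM2l).
by rewrite ler_peMr//; lra.
Qed.

Lemma Rintegral_quad k0 k1 k2 k3 k4 :
  \int[mu]_x quad k0 k1 k2 k3 k4 x =
  k0 + k1 * mean_a mu + k2 * mean_b mu + k3 * mean_c mu + k4 * mean_q mu.
Proof.
have ia := integrable_ca; have ib := integrable_cb; have ic := integrable_cc.
have i1 : mu.-integrable setT (EFin \o (fun x : borel X => k0 + k1 * ca x)).
  by apply: integrable_addR; [exact: integrable_cstR|exact: integrable_scaleR].
have i2 : mu.-integrable setT
    (EFin \o (fun x : borel X => k0 + k1 * ca x + k2 * cb x)).
  by apply: integrable_addR; [exact: i1|exact: integrable_scaleR].
have i3 : mu.-integrable setT
    (EFin \o (fun x : borel X => k0 + k1 * ca x + k2 * cb x + k3 * cc x)).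
  by apply: integrable_addR; [exact: i2|exact: integrable_scaleR].
rewrite /quad RintegralD//; last exact: integrable_scaleR.
rewrite RintegralD//; last exact: integrable_scaleR.
rewrite RintegralD//; last exact: integrable_scaleR.
rewrite RintegralD//; [|exact: integrable_cstR|exact: integrable_scaleR].
rewrite !RintegralZl// Rintegral_cst//.
by rewrite [X in fine X]probability_setT /= mulr1.
Qed.

End finite_moment_integrals.

Lemma finite_moment_wasserstein (mu : wasserstein_space X (2 : R)) :
  finite_moment mu.
Proof.
case: mu => mu /= [x0 oo].
have mf : measurable_fun setT (fun x : borel X => mdist x0 x ^+ 2 : R).
  exact: measurable_funX (measurable_mdistr x0).
have fi : mu.-integrable setT (EFin \o (fun x : borel X => mdist x0 x ^+ 2)).
  apply: ge0_integrable => //; first by move=> x; exact: sqr_ge0.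
  apply: le_lt_trans oo; rewrite le_eqVlt; apply/orP; left; apply/eqP.
  by apply: eq_integral => x _; rewrite powR_mulrn ?mdist_ge0.
(* This dominates [cq x]: in the plane, the difference contains the square of the norm of
   [2 x0 - x]. *)
have fi2 : mu.-integrable setT
    (EFin \o (fun x : borel X => 2 * cq x0 + 2 * mdist x0 x ^+ 2)).
  by apply: integrable_addR; [exact: integrable_cstR|exact: integrable_scaleR].
apply: le_integrable fi2 => //; first by apply/measurable_EFinP; exact: measurable_cq.
move=> x _; rewrite /= lee_fin ger0_norm ?cq_ge0// (le_trans _ (ler_norm _))//.
rewrite mdist_sqr /cq.
have := sqr_ge0 (2 * ca x0 - ca x); have := sqr_ge0 (2 * cb x0 - cb x).
have := sqr_ge0 (cc x0 - cc x); nra.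
Qed.

Lemma mdist_None_sqr x : mdist (None : X) x ^+ 2 = cq x + cc x :> R.
Proof. by rewrite mdist_sqr /cq; case: x => [u|] /=; ring. Qed.

Lemma finite_moment_exists mu : finite_moment mu ->
  exists x0 : X, (\int[mu]_x (mdist x0 x `^ 2)%:E < +oo)%E.
Proof.
move=> mu2; exists (None : X).
have := integrable_lty measurableT (integrable_quad mu2 0 0 0 1 1).
apply: le_lt_trans; rewrite le_eqVlt; apply/orP; left; apply/eqP.
apply: eq_integral => x _; rewrite powR_mulrn ?mdist_ge0// mdist_None_sqr.
by rewrite /= /quad; congr EFin; ring.
Qed.

Definition wasserstein_of mu (mu2 : finite_moment mu) : wasserstein_space X (2 : R) :=
  WassersteinSpace (finite_moment_exists mu2).

(* [cc] is idempotent, hence enters [quad] only linearly. *)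
Lemma mdist_quad x y : mdist x y ^+ 2 =
  quad (cq x + cc x) (- 2 * ca x) (- 2 * cb x) (1 - 2 * cc x) 1 y.
Proof.
by rewrite mdist_sqr /quad /cq; case: x y => [u|] [v|] /=; ring.
Qed.

Lemma mean_c_ge0 mu : 0 <= mean_c mu.
Proof. by apply: Rintegral_ge0 => x _; exact: cc_ge0. Qed.

Lemma mean_q_ge0 mu : 0 <= mean_q mu.
Proof. by apply: Rintegral_ge0 => x _; exact: cq_ge0. Qed.

Lemma mean_c_le1 mu : finite_moment mu -> mean_c mu <= 1.
Proof.
move=> mu2.
have -> : (1 : R) = \int[mu]_x quad 1 0 0 0 0 x.
  by rewrite Rintegral_quad//; ring.
apply: le_Rintegral => //; [exact: integrable_cc|exact: integrable_quad|].
by move=> [u|] _; rewrite /quad /=; lra.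
Qed.

Lemma transport_costC mu nu : transport_cost mu nu = transport_cost nu mu.
Proof.
wlog suff : mu nu / (transport_cost mu nu <= transport_cost nu mu)%E.
  by move=> h; apply/eqP; rewrite eq_le !h.
apply: le_ereal_inf_tmp => _ [pi cpi <-].
have ms : measurable_fun setT
    ((fun z : X * X => (z.2, z.1)) : borel (X * X)%type -> borel (X * X)%type).
  by apply: measurable_to_plane_pair; [exact: measurable_snd_borel|
    exact: measurable_fst_borel].
have mc : measurable_fun setT (fun z : borel (X * X)%type => mdist z.1 z.2 ^+ 2 : R).
  exact: measurable_funX measurable_mdist.
apply: (@le_trans _ _ (\int[push_prob pi ms]_z (mdist z.1 z.2 ^+ 2)%:E)%E).
  by apply: transport_cost_le => A mA; case: (cpi A mA).
rewrite integral_push_prob//; last by move=> z; exact: sqr_ge0.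
rewrite le_eqVlt; apply/orP; left; apply/eqP; apply: eq_integral => z _ /=.
by rewrite metric_sym.
Qed.

(** The image of [mu] under [y |-> (y, T y)] is a coupling. *)
Lemma transport_cost_map mu (T : borel X -> borel X) (mT : measurable_fun setT T) :
  (transport_cost mu (push_prob mu mT) <= \int[mu]_y (mdist y (T y) ^+ 2)%:E)%E.
Proof.
have mp : measurable_fun setT ((fun y : borel X => (y, T y) : X * X) : borel X -> borel (X * X)%type).
  by apply: measurable_to_plane_pair.
have mc : measurable_fun setT (fun z : borel (X * X)%type => mdist z.1 z.2 ^+ 2 : R).
  exact: measurable_funX measurable_mdist.
apply: (@le_trans _ _ (\int[push_prob mu mp]_z (mdist z.1 z.2 ^+ 2)%:E)%E).
  by apply: transport_cost_le => A mA.
by rewrite integral_push_prob//; move=> z; exact: sqr_ge0.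
Qed.

(** The product measure is a coupling. When the square is expanded, its cross term becomes the inner
    product of the means. *)
Lemma transport_cost_product mu nu : finite_moment mu -> finite_moment nu ->
  (transport_cost mu nu <=
   (mean_q mu + mean_c mu + mean_q nu + mean_c nu - 2 * (mean_a mu * mean_a nu +
     mean_b mu * mean_b nu + mean_c mu * mean_c nu))%:E)%E.
Proof.
move=> mu2 nu2.
have mp : measurable_fun setT
    ((fun z : borel X * borel X => (z.1, z.2) : X * X) : borel X * borel X -> borel (X * X)%type).
  by apply: measurable_to_plane_pair.
have mc : measurable_fun setT (fun z : borel (X * X)%type => mdist z.1 z.2 ^+ 2 : R).
  exact: measurable_funX measurable_mdist.
pose P : probability _ R := (mu \x nu)%E.
have cP : coupling mu nu (push_prob P mp).
  move=> A mA; split.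
    have -> : push_prob P mp (fst @^-1` A) = (mu \x nu)%E (A `*` setT).
      by congr ((mu \x nu)%E _); apply/seteqP; split => [z|z []].
    by rewrite product_measure1E// [X in (_ * X)%E]probability_setT mule1.
  have -> : push_prob P mp (snd @^-1` A) = (mu \x nu)%E (setT `*` A).
    by congr ((mu \x nu)%E _); apply/seteqP; split => [z|z []].
  by rewrite product_measure1E// [X in (X * _)%E]probability_setT mul1e.
apply: le_trans (transport_cost_le cP) _.
rewrite integral_push_prob//; last by move=> z; exact: sqr_ge0.
rewrite fubini_tonelli1//=; last 2 first.
- by apply/measurable_EFinP; have := measurableT_comp mc mp; exact.
- by move=> z; rewrite lee_fin sqr_ge0.
rewrite /fubini_F/=.
(* The inner integral over [z] is again of the form [quad], so the outer one is read off from the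
   moments of [mu]. *)
pose k y := quad (mean_q nu + mean_c nu) (- 2 * mean_a nu) (- 2 * mean_b nu)
   (1 - 2 * mean_c nu) 1 y.
under eq_integral => y _.
  rewrite (_ : (\int[nu]_z _)%E = (k y)%:E); last first.
    under eq_integral do rewrite mdist_quad.
    rewrite (integrable_EFinE (integrable_quad nu2 _ _ _ _ _)).
    by rewrite Rintegral_quad// /k /quad; congr EFin; ring.
  over.
rewrite (integrable_EFinE (integrable_quad mu2 _ _ _ _ _)) Rintegral_quad//.
by rewrite lee_fin le_eqVlt; apply/orP; left; apply/eqP; ring.
Qed.

End moments.

(** * Point masses, and the diameter of spheres around the one at q *)

Section point_masses.
Context {R : realType}.
Local Notation X := (plane_with_point R).
Local Notation W := (wasserstein_space X (2 : R)).
Implicit Types (mu nu rho : probability (borel X) R) (x y z : X).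

Lemma finite_moment_at mu x : mu [set x] = 1%E -> finite_moment mu.
Proof.
move=> mux; apply/integrableP; split.
  by apply/measurable_EFinP; exact: measurable_cq.
have mx := measurable_set1_borel x.
have mxC : measurable (~` [set x] : set (borel X)) by exact: measurableC.
have muC : mu (~` [set x]) = 0%E by rewrite probability_setC// mux subee.
rewrite (ge0_negligible_integral mxC measurableT)//; last first.
  by apply: measurableT_comp => //; apply/measurable_EFinP; exact: measurable_cq.
rewrite setTD setCK (eq_integral (cst (cq x)%:E)); last first.
  by move=> y; rewrite inE => -> /=; rewrite ger0_norm ?cq_ge0.
by rewrite integral_cst// [X in (_ * X)%E]mux mule1 ltry.
Qed.

Lemma means_at mu x : mu [set x] = 1%E ->
  [/\ mean_a mu = ca x, mean_b mu = cb x, mean_c mu = cc x & mean_q mu = cq x].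
Proof.
move=> mux; have mu2 := finite_moment_at mux.
have mx := measurable_set1_borel x.
have E (f : X -> R) : mu.-integrable setT (EFin \o (f : borel X -> R)) ->
    \int[mu]_y f y = f x.
  move=> fi; rewrite (@Rintegral_eq_on _ _ _ mu _ f (quad (f x) 0 0 0 0) mx)//.
  - by rewrite Rintegral_quad//; ring.
  - exact: integrable_quad.
  - by move=> y ->; rewrite /quad; ring.
split; apply: E => //.
- exact: integrable_ca.
- exact: integrable_cb.
- exact: integrable_cc.
Qed.

(** The assumed moments make the integral of the squared distance to [x] vanish. *)
Lemma mass_at mu x : finite_moment mu -> mean_a mu = ca x -> mean_b mu = cb x ->
  mean_c mu = cc x -> mean_q mu = cq x -> mu [set x] = 1%E.
Proof.
move=> mu2 ea eb ec eq.
have mf : measurable_fun setT (fun y : borel X => mdist x y ^+ 2 : R).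
  exact: measurable_funX (measurable_mdistr x).
have e : (fun y : borel X => mdist x y ^+ 2) =
    quad (cq x + cc x) (- 2 * ca x) (- 2 * cb x) (1 - 2 * cc x) 1.
  by apply/funext => y; rewrite mdist_quad.
have <- : [set y : borel X | mdist x y ^+ 2 = 0 :> R] = [set x].
  apply/seteqP; split => [y /eqP|y ->] /=; last by rewrite mdistxx expr0n.
  by rewrite sqrf_eq0 => /eqP/mdist_positivity.
apply: Rintegral_eq0_on => //; first by move=> y; exact: sqr_ge0.
  by rewrite e; exact: integrable_quad.
rewrite e Rintegral_quad// ea eb ec eq /cq.
by have := ccP x; nra.
Qed.

(** The product coupling gives the upper bound; the dual pair made of the squared distance to [x]
    and [0] gives the lower one. *)
Lemma transport_cost_at mu nu x : finite_moment mu -> nu [set x] = 1%E ->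
  transport_cost mu nu = (mean_q mu + mean_c mu + cq x + cc x -
    2 * (mean_a mu * ca x + mean_b mu * cb x + mean_c mu * cc x))%:E.
Proof.
move=> mu2 nux; have [ea eb ec eq] := means_at nux.
have nu2 := finite_moment_at nux.
apply/eqP; rewrite eq_le; apply/andP; split.
  by have := transport_cost_product mu2 nu2; rewrite ea eb ec eq.
apply: le_trans (@weak_duality _ _ mu nu
  (quad (cq x + cc x) (- 2 * ca x) (- 2 * cb x) (1 - 2 * cc x) 1)
  (quad 0 0 0 0 0) setT [set x] measurableT (probability_setT mu)
  (measurable_set1_borel x) nux (measurable_quad _ _ _ _ _)
  (integrable_quad mu2 _ _ _ _ _) (measurable_quad _ _ _ _ _)
  (integrable_quad nu2 _ _ _ _ _) _).
  rewrite !Rintegral_quad// lee_fin le_eqVlt; apply/orP; left; apply/eqP; ring.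
move=> y z _ ->; rewrite metric_sym mdist_quad /quad; lra.
Qed.

Lemma mean_c0 mu : finite_moment mu -> mean_c mu <= 0 -> mu [set (None : X)] = 1%E.
Proof.
move=> mu2 c0.
have <- : [set x : borel X | cc x = 0] = [set (None : X)].
  apply/seteqP; split => [[u|]|_ ->]//= /eqP; by rewrite oner_eq0.
apply: Rintegral_eq0_on => //.
- exact: measurable_cc.
- exact: cc_ge0.
- exact: integrable_cc.
Qed.

(** Since [ca] and [cb] vanish at q, this is Cauchy-Schwarz for [ca * cc] and [cb * cc]. For [C > 0]
    it comes from integrating the squared norm of [C (ca, cb) - (A, B) cc]; otherwise [mu] is the
    point mass at q. *)
Lemma mean_cauchy_schwarz mu : finite_moment mu ->
  mean_a mu ^+ 2 + mean_b mu ^+ 2 <= mean_c mu * mean_q mu.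
Proof.
move=> mu2; have [c0|c0] := leP (mean_c mu) 0.
  by have [-> -> -> ->] := means_at (mean_c0 mu2 c0); rewrite /cq /=; lra.
set A := mean_a mu; set B := mean_b mu; set C := mean_c mu.
have : 0 <= \int[mu]_x quad 0 (- 2 * A * C) (- 2 * B * C) (A ^+ 2 + B ^+ 2) (C ^+ 2) x.
  apply: Rintegral_ge0 => x _.
  rewrite (_ : quad _ _ _ _ _ x = (C * ca x - A * cc x) ^+ 2 + (C * cb x - B * cc x) ^+ 2).
    by rewrite addr_ge0 ?sqr_ge0.
  by rewrite /quad /cq; case: x => [u|] /=; ring.
rewrite Rintegral_quad// -/A -/B -/C => h.
suff : 0 <= C * (C * mean_q mu - (A ^+ 2 + B ^+ 2)).
  by rewrite pmulr_rge0// subr_ge0.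
by apply: le_trans h _; rewrite le_eqVlt; apply/orP; left; apply/eqP; ring.
Qed.

(* With the product coupling as competitor, the diameter of the sphere of
   squared radius [s] around the point mass at q is bounded by [4 (s - 1)],
   attained only by antipodal point masses in the plane. *)
Lemma antipodal_point_mass mu nu (s : R) : finite_moment mu -> finite_moment nu ->
  4 <= s -> mean_q mu + mean_c mu = s -> mean_q nu + mean_c nu = s ->
  ((4 * (s - 1))%:E <= transport_cost mu nu)%E ->
  mu [set (Some (pt (mean_a mu) (mean_b mu)) : X)] = 1%E.
Proof.
move=> mu2 nu2 s4 smu snu /le_trans/(_ (transport_cost_product mu2 nu2)).
rewrite lee_fin.
have := mean_cauchy_schwarz mu2; have := mean_cauchy_schwarz nu2.
have := mean_c_le1 mu2; have := mean_c_le1 nu2.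
have := mean_c_ge0 mu; have := mean_c_ge0 nu.
move=> c0 c0' c1 c1' cs cs' le.
(* Let [u] be the sum of the two planar masses. Cauchy-Schwarz turns the cost bound into
   [(2 - u) s <= (2 - u) (2 + u)], so [u < 2] would give [s < 4]. *)
have ux : 2 <= mean_c mu + mean_c nu.
  rewrite leNgt; apply/negP => u2.
  have : (2 - (mean_c mu + mean_c nu)) * s <=
         (2 - (mean_c mu + mean_c nu)) * (2 + (mean_c mu + mean_c nu)).
    have := sqr_ge0 (mean_a mu + mean_a nu); have := sqr_ge0 (mean_b mu + mean_b nu).
    by move: cs cs' le; rewrite -(addrK (mean_c mu) (mean_q mu)) smu
      -(addrK (mean_c nu) (mean_q nu)) snu; nra.
  rewrite ler_pM2l ?subr_gt0//; lra.
have ec : mean_c mu = 1 by lra.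
have ec' : mean_c nu = 1 by lra.
apply: mass_at => //; rewrite ?ca_pt ?cb_pt// /cq ca_pt cb_pt.
(* Both planar masses being 1, the cost bound forces equality in Cauchy-Schwarz. *)
have := sqr_ge0 (mean_a mu + mean_a nu); have := sqr_ge0 (mean_b mu + mean_b nu).
move: cs cs' le smu snu; rewrite ec ec' => cs cs' le smu snu h1 h2.
by apply/eqP; rewrite eq_le; apply/andP; split; nra.
Qed.

Definition delta x : probability (borel X) R := \d_(x : borel X).

Lemma delta_at x : delta x [set x] = 1%E.
Proof. by rewrite /delta /= diracE mem_set. Qed.

Definition deltaW x : W := wasserstein_of (finite_moment_at (delta_at x)).

End point_masses.

(** * Midpoints in the Wasserstein space *)

Section midpoints.
Context {R : realType}.
Local Notation X := (plane_with_point R).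
Local Notation W := (wasserstein_space X (2 : R)).
Implicit Types (mu nu rho : probability (borel X) R) (x y z : X).

(** The shift [p] along the first axis serves measures whose planar part sits at the origin, where
    scaling does nothing. *)
Definition homothety (s p : R) x : X :=
  if x is Some u then Some (pt (s * ca x + p) (s * cb x)) else None.

Lemma ca_homothety s p x : ca (homothety s p x) = s * ca x + p * cc x.
Proof. by case: x => [u|]; rewrite /homothety ?ca_pt /=; ring. Qed.

Lemma cb_homothety s p x : cb (homothety s p x) = s * cb x.
Proof. by case: x => [u|]; rewrite /homothety ?cb_pt /=; ring. Qed.

Lemma cc_homothety s p x : cc (homothety s p x) = cc x.
Proof. by case: x. Qed.

Lemma measurable_homothety s p :
  measurable_fun setT (homothety s p : borel X -> borel X).
Proof.
have ma : measurable_fun setT (fun x : borel X => s * ca x + p * cc x).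
  by apply: measurable_funD; apply: measurable_funM => //;
    [exact: measurable_ca|exact: measurable_cc].
have mb : measurable_fun setT (fun x : borel X => s * cb x).
  by apply: measurable_funM => //; exact: measurable_cb.
have mc := @measurable_cc R.
apply: measurable_to_plane.
- by rewrite (_ : _ \o _ = fun x => s * ca x + p * cc x)//; apply/funext => x /=;
    rewrite ca_homothety.
- by rewrite (_ : _ \o _ = fun x => s * cb x)//; apply/funext => x /=;
    rewrite cb_homothety.
- by rewrite (_ : _ \o _ = cc)//; apply/funext => x /=; rewrite cc_homothety.
Qed.

Definition push_homothety mu s p := push_prob mu (measurable_homothety s p).

Lemma cq_homothety s p x : cq (homothety s p x) = quad 0 (2 * s * p) 0 (p ^+ 2) (s ^+ 2) x.
Proof.
rewrite {1}/cq ca_homothety cb_homothety /quad /cq.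
by case: x => [u|] /=; ring.
Qed.

Lemma finite_moment_homothety mu s p : finite_moment mu ->
  finite_moment (push_homothety mu s p).
Proof.
move=> mu2; apply: integrable_push_prob; first exact: measurable_cq.
rewrite (_ : _ \o _ = quad 0 (2 * s * p) 0 (p ^+ 2) (s ^+ 2)).
  exact: integrable_quad.
by apply/funext => x /=; rewrite cq_homothety.
Qed.

Lemma mean_q_homothety mu s p : finite_moment mu ->
  mean_q (push_homothety mu s p) =
  2 * s * p * mean_a mu + p ^+ 2 * mean_c mu + s ^+ 2 * mean_q mu.
Proof.
move=> mu2; have e : cq \o homothety s p = quad 0 (2 * s * p) 0 (p ^+ 2) (s ^+ 2).
  by apply/funext => x /=; rewrite cq_homothety.
rewrite /mean_q Rintegral_push_prob//.
- under eq_Rintegral do rewrite cq_homothety.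
  by rewrite Rintegral_quad// /mean_q; ring.
- exact: measurable_cq.
- by rewrite e; exact: integrable_quad.
Qed.

Lemma mean_c_homothety mu s p : finite_moment mu ->
  mean_c (push_homothety mu s p) = mean_c mu.
Proof.
move=> mu2; rewrite /mean_c Rintegral_push_prob//.
- by under eq_Rintegral do rewrite cc_homothety.
- exact: measurable_cc.
- rewrite (_ : _ \o _ = cc); first exact: integrable_cc.
  by apply/funext => x /=; rewrite cc_homothety.
Qed.

Lemma homothety_comp mu s p s' p' s2 p2 :
  s2 = s' * s -> p2 = s' * p + p' -> same_measure
  (push_homothety mu s2 p2) (push_homothety (push_homothety mu s p) s' p').
Proof.
move=> -> -> A mA.
change (mu (homothety (s' * s) (s' * p + p') @^-1` A) =
  mu (homothety s p @^-1` (homothety s' p' @^-1` A))); congr (mu _).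
apply/funext => x /=; congr (A _); apply: plane_inj.
- by rewrite !ca_homothety cc_homothety; ring.
- by rewrite !cb_homothety; ring.
- by rewrite !cc_homothety.
Qed.

Lemma transport_cost_homothety mu s p : finite_moment mu ->
  (transport_cost mu (push_homothety mu s p) <=
   ((1 - s) ^+ 2 * mean_q mu - 2 * (1 - s) * p * mean_a mu + p ^+ 2 * mean_c mu)%:E)%E.
Proof.
move=> mu2; apply: le_trans (transport_cost_map _ _) _.
under eq_integral => y _.
  rewrite (_ : mdist _ _ ^+ 2 =
    quad 0 (- 2 * (1 - s) * p) 0 (p ^+ 2) ((1 - s) ^+ 2) y); last first.
    rewrite mdist_sqr ca_homothety cb_homothety cc_homothety /quad /cq.
    by case: y => [u|] /=; ring.
  over.
rewrite (integrable_EFinE (integrable_quad mu2 _ _ _ _ _)) Rintegral_quad//.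
by rewrite lee_fin le_eqVlt; apply/orP; left; apply/eqP; ring.
Qed.

(** Costs are squared distances, so half the distance becomes a quarter of the cost. The bounds are
    one-sided so that couplings and dual potentials can supply them; [0 < c] excludes the trivial
    midpoint. *)
Definition has_midpoint mu := exists (nu rho : W) (c : R),
  [/\ 0 < c, (c%:E <= transport_cost mu rho)%E,
      (transport_cost mu nu <= (c / 4)%:E)%E &
      (transport_cost nu rho <= (c / 4)%:E)%E].

(** Slide the planar part and leave the mass at q in place: towards the origin if it is not already
    there, along the first axis otherwise. *)
Lemma has_midpoint_plane mu : finite_moment mu -> 0 < mean_c mu -> has_midpoint mu.
Proof.
move=> mu2 c0; have [q0|q0] := ltP 0 (mean_q mu).
  pose nu := push_homothety mu (1 / 2) 0.
  pose rho := push_homothety mu 0 0.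
  have nu2 : finite_moment nu by exact: finite_moment_homothety.
  have rho2 : finite_moment rho by exact: finite_moment_homothety.
  exists (wasserstein_of nu2), (wasserstein_of rho2), (mean_q mu); split => //=.
  - have mZ : measurable ([set x | cq x = 0] : set (borel X)).
      rewrite (_ : [set _ | _] = cq @^-1` [set 0])//.
      by rewrite -[_ @^-1` _]setTI; exact: (@measurable_cq R).
    have rhoZ : rho [set x : X | cq x = 0] = 1%E.
      rewrite /rho /push_homothety push_probE -(probability_setT mu).
      congr (mu _); apply/seteqP; split => // x _ /=.
      by rewrite cq_homothety /quad; ring.
    (* The potentials [cq] and [0] are admissible because [rho] lives where [cq] vanishes. *)
    apply: le_trans (@weak_duality _ _ mu rho cq (quad 0 0 0 0 0) setT _
      measurableT (probability_setT mu) mZ rhoZ (@measurable_cq R) mu2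
      (measurable_quad _ _ _ _ _) (integrable_quad rho2 _ _ _ _ _) _).
      rewrite Rintegral_quad// lee_fin -/(mean_q mu).
      by rewrite le_eqVlt; apply/orP; left; apply/eqP; ring.
    move=> y z _ /eqP; rewrite /= paddr_eq0 ?sqr_ge0// !sqrf_eq0 => /andP[/eqP za /eqP zb].
    by rewrite mdist_sqr za zb /quad /cq !subr0; have := sqr_ge0 (cc y - cc z); lra.
  - apply: le_trans (transport_cost_homothety _ _ mu2) _.
    by rewrite lee_fin; lra.
  - rewrite (@transport_cost_same_measurer _ _ nu rho (push_homothety nu 0 0)).
      apply: le_trans (transport_cost_homothety _ _ nu2) _.
      by rewrite mean_q_homothety// lee_fin; lra.
    by apply: homothety_comp; ring.
(* The planar part now sits at the origin; it is translated by 1/2 and by 1. *)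
have mu0 : mu [set x : borel X | cq x = 0] = 1%E.
  apply: Rintegral_eq0_on => //; [exact: measurable_cq|exact: cq_ge0].
have mZ : measurable ([set x | cq x = 0] : set (borel X)).
  rewrite (_ : [set _ | _] = cq @^-1` [set 0])//.
  by rewrite -[_ @^-1` _]setTI; exact: (@measurable_cq R).
have q00 : mean_q mu = 0 by apply/eqP; rewrite eq_le q0 mean_q_ge0.
have a00 : mean_a mu = 0.
  have := mean_cauchy_schwarz mu2; rewrite q00 mulr0 => h.
  by apply/eqP; rewrite -sqrf_eq0 eq_le sqr_ge0 andbT; have := sqr_ge0 (mean_b mu); lra.
pose nu := push_homothety mu 1 (1 / 2).
pose rho := push_homothety mu 1 1.
have nu2 : finite_moment nu by exact: finite_moment_homothety.
have rho2 : finite_moment rho by exact: finite_moment_homothety.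
exists (wasserstein_of nu2), (wasserstein_of rho2), (mean_c mu); split => //=.
- apply: le_trans (@weak_duality _ _ mu rho (quad 0 0 0 0 0) cq _ setT
    mZ mu0 measurableT (probability_setT rho)
    (measurable_quad _ _ _ _ _) (integrable_quad mu2 _ _ _ _ _)
    (@measurable_cq R) rho2 _).
    rewrite Rintegral_quad// lee_fin -/(mean_q rho) mean_q_homothety// q00 a00.
    by rewrite le_eqVlt; apply/orP; left; apply/eqP; ring.
  move=> y z /eqP; rewrite /= paddr_eq0 ?sqr_ge0// !sqrf_eq0 => /andP[/eqP ya /eqP yb] _.
  by rewrite mdist_sqr ya yb /quad /cq !sub0r !sqrrN; have := sqr_ge0 (cc y - cc z); lra.
- apply: le_trans (transport_cost_homothety _ _ mu2) _.
  by rewrite lee_fin q00 a00; lra.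
- rewrite (@transport_cost_same_measurer _ _ nu rho (push_homothety nu 1 (1 / 2))).
    apply: le_trans (transport_cost_homothety _ _ nu2) _.
    by rewrite mean_q_homothety// mean_c_homothety// q00 a00 lee_fin; lra.
  by apply: homothety_comp; lra.
Qed.

(* The parallelogram law in R^3: a midpoint of q and a point of the plane lies
   at height 1/2, hence at distance at least 1/2 from the space. *)
Lemma no_midpoint_at_q mu : mu [set (None : X)] = 1%E -> ~ has_midpoint mu.
Proof.
move=> muq [nu [rho [c [c0 hr hn hnr]]]].
have nu2 := finite_moment_wasserstein nu.
have rho2 := finite_moment_wasserstein rho.
have cE (k : W) : transport_cost mu k = (mean_q k + mean_c k)%:E.
  rewrite transport_costC (transport_cost_at (finite_moment_wasserstein k) muq).
  by rewrite /cq /=; congr EFin; ring.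
rewrite cE lee_fin in hr; rewrite cE lee_fin in hn.
(* The potentials come from [|y - z|^2 + |y|^2 = |z|^2 / 2 + |2 y - z|^2 / 2] in R^3: if [cc z = 1],
   the third coordinate makes the last term at least 1/2. *)
have : (((1 / 2) * (mean_q rho + 2 * mean_c rho) - (mean_q nu + mean_c nu))%:E
    <= transport_cost nu rho)%E.
  apply: le_trans (@weak_duality _ _ nu rho (quad 0 0 0 (-1) (-1))
    (quad 0 0 0 1 (1 / 2)) setT setT measurableT (probability_setT nu)
    measurableT (probability_setT rho) (measurable_quad _ _ _ _ _)
    (integrable_quad nu2 _ _ _ _ _) (measurable_quad _ _ _ _ _)
    (integrable_quad rho2 _ _ _ _ _) _).
    by rewrite !Rintegral_quad// lee_fin; lra.
  move=> y z _ _; rewrite mdist_sqr /quad /cq.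
  have := sqr_ge0 (ca z - 2 * ca y); have := sqr_ge0 (cb z - 2 * cb y).
  by case: y z => [u|] [v|] /=; nra.
move=> /le_trans/(_ hnr); rewrite lee_fin => le.
(* So far [mean_q rho / 2 + mean_c rho <= c / 2], while [c <= mean_q rho + mean_c rho]. *)
have rc0 : mean_c rho <= 0 by lra.
have [_ _ ec eq] := means_at (mean_c0 rho2 rc0).
by move: hr; rewrite ec eq /cq /=; lra.
Qed.

End midpoints.

(** * Action of an isometry on point masses and on moments *)

Section isometry_on_point_masses.
Context {R : realType}.
Local Notation X := (plane_with_point R).
Local Notation W := (wasserstein_space X (2 : R)).
Variable Phi : W -> W.
Hypothesis isoPhi : is_wasserstein_isometry Phi.

Lemma transport_cost_isometry (mu nu : W) :
  transport_cost (Phi mu) (Phi nu) = transport_cost mu nu.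
Proof. by apply: eq_transport_cost; exact: isoPhi.1. Qed.

Lemma has_midpoint_isometry (mu : W) : has_midpoint mu -> has_midpoint (Phi mu).
Proof.
move=> [nu [rho [c [c0 h1 h2 h3]]]]; exists (Phi nu), (Phi rho), c.
by split; rewrite ?transport_cost_isometry.
Qed.

(** A preimage of the point mass at q has no midpoint, since [Phi] carries midpoints over; hence it
    is itself the point mass at q. *)
Lemma isometry_fixes_q : Phi (deltaW (None : X)) [set (None : X)] = 1%E.
Proof.
have [mu hmu] := isoPhi.2 (deltaW (None : X)).
have mu2 := finite_moment_wasserstein mu.
have muq : mu [set (None : X)] = 1%E.
  apply: (mean_c0 mu2); rewrite leNgt; apply/negP => /(has_midpoint_plane mu2).
  move=> /has_midpoint_isometry; apply: no_midpoint_at_q.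
  rewrite (hmu _ (measurable_set1_borel _)); exact: delta_at.
(* [mu] and [deltaW None] agree only as measures, so their images are compared through their
   distance, which is 0. *)
have e0 : transport_cost (Phi (deltaW (None : X))) (Phi mu) = 0%:E.
  rewrite transport_cost_isometry.
  rewrite (transport_cost_at (finite_moment_wasserstein _) muq).
  have [-> -> -> ->] := means_at (delta_at (None : X)).
  by rewrite /cq /=; congr EFin; ring.
have qP2 := finite_moment_wasserstein (Phi (deltaW (None : X))).
rewrite (transport_cost_same_measurer _ hmu) in e0.
rewrite (transport_cost_at qP2 (delta_at _)) in e0.
case: e0; rewrite /cq /= => e0; apply: (mean_c0 qP2).
by have := mean_q_ge0 (Phi (deltaW (None : X))); lra.
Qed.

(** Both sides are the cost to the point mass at q, which [Phi] fixes. *)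
Lemma isometry_norm (mu : W) :
  mean_q (Phi mu) + mean_c (Phi mu) = mean_q mu + mean_c mu.
Proof.
have := transport_cost_isometry mu (deltaW (None : X)).
rewrite (transport_cost_at (finite_moment_wasserstein _) isometry_fixes_q).
rewrite (transport_cost_at (finite_moment_wasserstein _) (delta_at _)).
by case; rewrite /cq /=; lra.
Qed.

Let D (p r : R) : W := deltaW (Some (pt p r) : X).
Let al p r := mean_a (Phi (D p r)).
Let be p r := mean_b (Phi (D p r)).

Let D_means p r : [/\ mean_a (D p r) = p, mean_b (D p r) = r, mean_c (D p r) = 1 &
  mean_q (D p r) = p ^+ 2 + r ^+ 2].
Proof.
have [-> -> -> ->] := means_at (delta_at (Some (pt p r) : X)).
by rewrite /cq ca_pt cb_pt.
Qed.

Let cost_D (mu : W) p r : transport_cost mu (D p r) =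
  (mean_q mu + mean_c mu + (p ^+ 2 + r ^+ 2) + 1 -
    2 * (mean_a mu * p + mean_b mu * r + mean_c mu))%:E.
Proof.
rewrite (transport_cost_at (finite_moment_wasserstein _) (delta_at _)).
by rewrite /cq ca_pt cb_pt mulr1.
Qed.

(** The squared distance to q is [s = p^2 + r^2 + 1], so 3 encodes [4 <= s]. The antipode
    [D (- p) (- r)] realizes the cost [4 (s - 1)]. *)
Let far_image p r : 3 <= p ^+ 2 + r ^+ 2 ->
  Phi (D p r) [set (Some (pt (al p r) (be p r)) : X)] = 1%E.
Proof.
move=> h; apply: (@antipodal_point_mass _ (Phi (D p r)) (Phi (D (- p) (- r)))
  (p ^+ 2 + r ^+ 2 + 1)).
- exact: finite_moment_wasserstein.
- exact: finite_moment_wasserstein.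
- lra.
- by rewrite isometry_norm; have [_ _ -> ->] := D_means p r.
- by rewrite isometry_norm; have [_ _ -> ->] := D_means (- p) (- r); rewrite !sqrrN.
- rewrite transport_cost_isometry cost_D lee_fin; have [-> -> -> ->] := D_means p r.
  by rewrite le_eqVlt; apply/orP; left; apply/eqP; ring.
Qed.

(** In the costs to [D p r] and to its image, the squared norms cancel and the inner products
    remain. *)
Let far_cost (mu : W) p r : 3 <= p ^+ 2 + r ^+ 2 ->
  mean_a (Phi mu) * al p r + mean_b (Phi mu) * be p r + mean_c (Phi mu) =
  mean_a mu * p + mean_b mu * r + mean_c mu.
Proof.
move=> h; have e := transport_cost_isometry mu (D p r).
rewrite (transport_cost_at (finite_moment_wasserstein _) (far_image h)) cost_D in e.
have [ea eb ec eq] := means_at (far_image h).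
have := isometry_norm (D p r); rewrite ec eq.
have [_ _ -> ->] := D_means p r.
case: e; rewrite isometry_norm; rewrite /cq /= !mxE /= !mulr1; lra.
Qed.

(** A right inverse of a square matrix is also a left inverse. *)
Lemma orthonormal_transpose (a b c d : R) : a ^+ 2 + b ^+ 2 = 1 ->
  c ^+ 2 + d ^+ 2 = 1 -> a * c + b * d = 0 ->
  [/\ a ^+ 2 + c ^+ 2 = 1, b ^+ 2 + d ^+ 2 = 1 & a * b + c * d = 0].
Proof.
move=> ab cd acbd.
pose M := \matrix_(i < 2, j < 2)
  (if i == 0 then if j == 0 then a else b else if j == 0 then c else d).
have sum2 (F : 'I_2 -> R) : \sum_(i < 2) F i = F 0 + F 1.
  by rewrite big_ord_recr big_ord1/=; congr (F _ + F _); apply/val_inj.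
have MM : M *m M^T = 1%:M.
  by apply/matrixP => -[[|[|//]] i2] [[|[|//]] j2]; rewrite !mxE sum2 !mxE/=; lra.
have := mulmx1C MM => /matrixP e.
have := e 0 0; have := e 0 1; have := e 1 1; rewrite !mxE !sum2 !mxE/= => e1 e2 e3.
by split; lra.
Qed.

(* Recovers an orthogonal matrix from the images of the point masses at
   [(2, 0)] and [(0, 2)], which are far enough from the origin. *)
Lemma isometry_means : exists a b c d : R,
  [/\ a ^+ 2 + b ^+ 2 = 1, c ^+ 2 + d ^+ 2 = 1, a * c + b * d = 0 &
   forall mu : W, [/\ mean_a (Phi mu) = mean_a mu * a + mean_b mu * c,
     mean_b (Phi mu) = mean_a mu * b + mean_b mu * d,
     mean_c (Phi mu) = mean_c mu & mean_q (Phi mu) = mean_q mu]].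
Proof.
have f1 : 3 <= (2 : R) ^+ 2 + 0 ^+ 2 by lra.
have f1' : 3 <= (- 2 : R) ^+ 2 + 0 ^+ 2 by lra.
have f2 : 3 <= (0 : R) ^+ 2 + 2 ^+ 2 by lra.
have cD p r : 3 <= p ^+ 2 + r ^+ 2 -> mean_c (Phi (D p r)) = 1.
  by move=> h; have [_ _ ->] := means_at (far_image h).
have ip p r p' r' : 3 <= p ^+ 2 + r ^+ 2 -> 3 <= p' ^+ 2 + r' ^+ 2 ->
    al p r * al p' r' + be p r * be p' r' = p * p' + r * r'.
  move=> h h'; have := far_cost (D p r) h'; rewrite cD//.
  by have [-> -> -> _] := D_means p r; rewrite /al /be; lra.
have i11 := ip _ _ _ _ f1 f1; have i12 := ip _ _ _ _ f1 f2.
have i22 := ip _ _ _ _ f2 f2; have i11' := ip _ _ _ _ f1 f1'.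
have i1'1' := ip _ _ _ _ f1' f1'.
pose a := al 2 0 / 2; pose b := be 2 0 / 2; pose c := al 0 2 / 2; pose d := be 0 2 / 2.
have ab : a ^+ 2 + b ^+ 2 = 1 by rewrite /a /b; lra.
have cd : c ^+ 2 + d ^+ 2 = 1 by rewrite /c /d; lra.
have acbd : a * c + b * d = 0 by rewrite /a /b /c /d; lra.
have [ac bd abcd] := orthonormal_transpose ab cd acbd.
(* The images of [(2, 0)] and [(-2, 0)] are opposite: their sum has squared norm 4 + 4 - 8. *)
have neg : al (- 2) 0 = - al 2 0 /\ be (- 2) 0 = - be 2 0.
  have : (al (- 2) 0 + al 2 0) ^+ 2 + (be (- 2) 0 + be 2 0) ^+ 2 = 0 by lra.
  move/eqP; rewrite paddr_eq0 ?sqr_ge0// !sqrf_eq0 !addr_eq0.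
  by move=> /andP[/eqP -> /eqP ->].
exists a, b, c, d; split => // mu.
have m1 := far_cost mu f1; have m2 := far_cost mu f2; have m1' := far_cost mu f1'.
rewrite neg.1 neg.2 in m1'.
(* Adding the relations for these two opposite points isolates [mean_c]. *)
have ec : mean_c (Phi mu) = mean_c mu by lra.
have eA : mean_a mu = mean_a (Phi mu) * a + mean_b (Phi mu) * b by rewrite /a /b; lra.
have eB : mean_b mu = mean_a (Phi mu) * c + mean_b (Phi mu) * d by rewrite /c /d; lra.
split => //.
- rewrite eA eB.
  transitivity (mean_a (Phi mu) * (a ^+ 2 + c ^+ 2) + mean_b (Phi mu) * (a * b + c * d)).
    by rewrite ac abcd; ring.
  by ring.
- rewrite eA eB.
  transitivity (mean_a (Phi mu) * (a * b + c * d) + mean_b (Phi mu) * (b ^+ 2 + d ^+ 2)).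
    by rewrite bd abcd; ring.
  by ring.
- by have := isometry_norm mu; lra.
Qed.

End isometry_on_point_masses.

(** * Distances to measures carried by q and one planar point *)

Section two_point_measures.
Context {R : realType}.
Local Notation X := (plane_with_point R).
Local Notation W := (wasserstein_space X (2 : R)).
Implicit Types (mu nu rho : probability (borel X) R) (x y z : X) (p r c s : R).

(* The moments of [c] times the point mass at [(p, r)] plus [1 - c] times the
   point mass at q, which determine it. *)
Definition two_point p r c rho := [/\ mean_a rho = c * p, mean_b rho = c * r,
  mean_c rho = c & mean_q rho = c * (p ^+ 2 + r ^+ 2)].

(** The inner product in R^3 with the planar point [(p, r)], whose third coordinate is 1. *)
Definition lin p r x : R := p * ca x + r * cb x + cc x.

(** As a function of [s], the integrated tail of the law of [lin p r] under [mu]. *)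
Definition excess mu p r s : R := \int[mu]_x Num.max 0 (lin p r x - s).

Lemma measurable_lin p r : measurable_fun setT (lin p r : borel X -> R).
Proof.
rewrite (_ : lin p r = quad 0 p r 1 0); first exact: measurable_quad.
by apply/funext => x; rewrite /lin /quad; ring.
Qed.

Lemma measurable_excess p r s :
  measurable_fun setT ((fun x => Num.max 0 (lin p r x - s)) : borel X -> R).
Proof.
apply: measurable_maxr => //; apply: measurable_funB => //.
exact: measurable_lin.
Qed.

Lemma integrable_excess mu p r s : finite_moment mu ->
  mu.-integrable setT (EFin \o (fun x : borel X => Num.max 0 (lin p r x - s))).
Proof.
move=> mu2; apply: le_integrable (integrable_quad mu2 (- s) p r 1 0) => //.
  by apply/measurable_EFinP; exact: measurable_excess.
move=> x _; rewrite /= lee_fin (_ : quad _ _ _ _ _ _ = lin p r x - s); last first.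
  by rewrite /quad /lin; ring.
rewrite ger0_norm ?le_max ?lexx// ge_max normr_ge0/=; exact: ler_norm.
Qed.

(** The squared norm of [(ca, cb) - (p, r) cc] is positive off q and [(p, r)], and the moments make
    its integral zero. *)
Lemma two_point_support p r c rho : finite_moment rho -> two_point p r c rho ->
  exists2 S : set X, measurable (S : set (borel X)) /\ rho S = 1%E &
    forall x, S x -> x = Some (pt p r) \/ x = None.
Proof.
move=> rho2 [ea eb ec eq].
pose f := quad 0 (- 2 * p) (- 2 * r) (p ^+ 2 + r ^+ 2) 1.
have fE x : f x = (ca x - p * cc x) ^+ 2 + (cb x - r * cc x) ^+ 2.
  by rewrite /f /quad /cq; case: x => [u|] /=; ring.
exists [set x | f x = 0]; first split.
- rewrite (_ : [set _ | _] = f @^-1` [set 0])//.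
  by rewrite -[_ @^-1` _]setTI; apply: measurable_quad.
- apply: Rintegral_eq0_on; [exact: measurable_quad| |exact: integrable_quad|].
    by move=> x; rewrite fE addr_ge0 ?sqr_ge0.
  by rewrite Rintegral_quad// ea eb ec eq; lra.
- move=> x /eqP; rewrite fE paddr_eq0 ?sqr_ge0// !sqrf_eq0 !subr_eq0.
  move=> /andP[/eqP xa /eqP xb]; have [[c0 [a0 b0]]|c1] := ccP x; [right|left];
  by apply: plane_inj; rewrite ?ca_pt ?cb_pt//= ?xa ?xb c1 mulr1.
Qed.

(** Let [x = (p, r)]. The potential [- t cc] on the two points has as conjugate the minimum of
    [|y|^2] and [|y - x|^2 + t] in R^3. The choice of [t] makes this
    [|y|^2 - 2 max(0, lin p r y - s)]. *)
Lemma two_point_cost_ge mu rho p r c s : finite_moment mu -> finite_moment rho ->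
  two_point p r c rho ->
  ((mean_q mu + mean_c mu - c * (2 * s - (p ^+ 2 + r ^+ 2 + 1))
    - 2 * excess mu p r s)%:E <= transport_cost mu rho)%E.
Proof.
move=> mu2 rho2 rhoS; have [S [mS rhoS1] SP] := two_point_support rho2 rhoS.
have [_ _ ec _] := rhoS.
set t := 2 * s - (p ^+ 2 + r ^+ 2 + 1).
pose phi x := quad 0 0 0 1 1 x + (- 2) * Num.max 0 (lin p r x - s).
have mphi : measurable_fun setT (phi : borel X -> R).
  apply: measurable_funD; first exact: measurable_quad.
  by apply: measurable_funM => //; exact: measurable_excess.
have i2 : mu.-integrable setT
    (EFin \o (fun x : borel X => (- 2) * Num.max 0 (lin p r x - s))).
  exact/integrable_scaleR/integrable_excess.
have phii : mu.-integrable setT (EFin \o (phi : borel X -> R)).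
  by apply: integrable_addR => //; exact: integrable_quad.
apply: le_trans (@weak_duality _ _ mu rho phi (quad 0 0 0 (- t) 0) setT S
  measurableT (probability_setT mu) mS rhoS1 mphi phii (measurable_quad _ _ _ _ _)
  (integrable_quad rho2 _ _ _ _ _) _).
  rewrite Rintegral_quad// RintegralD//; last exact: integrable_quad.
  rewrite Rintegral_quad// RintegralZl//; last exact: integrable_excess.
  rewrite -/(excess mu p r s) lee_fin ec.
  by rewrite le_eqVlt; apply/orP; left; apply/eqP; ring.
move=> y z _ /SP hz; rewrite metric_sym mdist_quad /phi.
have m1 : 0 <= Num.max 0 (lin p r y - s) by rewrite le_max lexx.
have m2 : lin p r y - s <= Num.max 0 (lin p r y - s) by rewrite le_max lexx orbT.
by move: m1 m2; case: hz => ->; rewrite /cq ?ca_pt ?cb_pt /quad /lin /t /=; lra.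
Qed.

(** [T] sends each point to whichever of [(p, r)] and q attains the minimum in the dual potential,
    so the image measure meets the lower bound; [c] is its mass at [(p, r)]. *)
Lemma two_point_cost_attained mu p r s : finite_moment mu ->
  exists (rho : W) (c : R), two_point p r c rho /\
  (transport_cost mu rho <= (mean_q mu + mean_c mu
    - c * (2 * s - (p ^+ 2 + r ^+ 2 + 1)) - 2 * excess mu p r s)%:E)%E.
Proof.
move=> mu2; set t := 2 * s - (p ^+ 2 + r ^+ 2 + 1).
pose T y : X := if s <= lin p r y then Some (pt p r) else None.
have caT y : ca (T y) = p * cc (T y).
  by rewrite /T; case: ifP => _; rewrite ?ca_pt /= ?mulr1 ?mulr0.
have cbT y : cb (T y) = r * cc (T y).
  by rewrite /T; case: ifP => _; rewrite ?cb_pt /= ?mulr1 ?mulr0.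
have cqT y : cq (T y) = (p ^+ 2 + r ^+ 2) * cc (T y).
  by rewrite /T /cq; case: ifP => _; rewrite ?ca_pt ?cb_pt /=; ring.
have mcT : measurable_fun setT ((cc \o T) : borel X -> R).
  rewrite (_ : cc \o T = fun y => if s <= lin p r y then 1 else 0); last first.
    by apply/funext => y /=; rewrite /T; case: ifP.
  apply: measurable_fun_ifT => //; apply: measurable_fun_ler => //.
  exact: measurable_lin.
have mT : measurable_fun setT (T : borel X -> borel X).
  apply: measurable_to_plane => //.
  - rewrite (_ : _ \o _ = fun y => p * cc (T y)); last by apply/funext => y; exact: caT.
    exact: measurable_funM.
  - rewrite (_ : _ \o _ = fun y => r * cc (T y)); last by apply/funext => y; exact: cbT.
    exact: measurable_funM.
have icT : mu.-integrable setT (EFin \o ((cc \o T) : borel X -> R)).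
  apply: (integrable_quad_bound mu2 (k := 1)) => // x; rewrite mul1r.
  by have := cq_ge0 x; rewrite /= /T; case: ifP => _ /=; rewrite ?normr1 ?normr0; lra.
pose rho := push_prob mu mT.
pose c := \int[mu]_y cc (T y).
have rhoE (f : X -> R) k : measurable_fun setT (f : borel X -> R) ->
    (forall y, f (T y) = k * cc (T y)) ->
    rho.-integrable setT (EFin \o (f : borel X -> R)) /\ \int[rho]_y f y = c * k.
  move=> mf fT.
  have e : f \o T = fun y => k * cc (T y) by apply/funext => y /=; exact: fT.
  have fi : mu.-integrable setT (EFin \o ((f \o T) : borel X -> R)).
    by rewrite e; exact: integrable_scaleR.
  split; first exact: integrable_push_prob.
  rewrite Rintegral_push_prob// /c -RintegralZr//.
  by apply: eq_Rintegral => y _; rewrite fT mulrC.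
have rho2 : finite_moment rho.
  by apply: (rhoE cq _ _ cqT).1; exact: measurable_cq.
exists (wasserstein_of rho2), c; split.
  split.
  - exact: (rhoE ca p (@measurable_ca R) caT).2.
  - exact: (rhoE cb r (@measurable_cb R) cbT).2.
  - have ccT y : cc (T y) = 1 * cc (T y) by rewrite mul1r.
    by rewrite -[RHS]mulr1; exact: (rhoE cc 1 (@measurable_cc R) ccT).2.
  - exact: (rhoE cq _ (@measurable_cq R) cqT).2.
apply: le_trans (transport_cost_map _ _) _.
pose g y := quad 0 0 0 1 1 y + ((- t) * cc (T y) + (- 2) * Num.max 0 (lin p r y - s)).
have gE y : mdist y (T y) ^+ 2 = g y.
  rewrite metric_sym mdist_quad /g /T; case: (lerP s (lin p r y)) => h.
    rewrite max_r ?subr_ge0//.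
    by rewrite /cq ca_pt cb_pt /quad /lin /t /=; ring.
  rewrite max_l ?subr_le0 ?ltW//.
  by rewrite /cq /quad /=; ring.
have i1 : mu.-integrable setT (EFin \o (fun x : borel X => (- t) * cc (T x))).
  exact: integrable_scaleR.
have i2 : mu.-integrable setT
    (EFin \o (fun x : borel X => (- 2) * Num.max 0 (lin p r x - s))).
  exact/integrable_scaleR/integrable_excess.
have i12 := integrable_addR i1 i2.
have gi : mu.-integrable setT (EFin \o (g : borel X -> R)).
  by apply: integrable_addR => //; exact: integrable_quad.
under eq_integral do rewrite gE.
rewrite (integrable_EFinE gi) lee_fin /g RintegralD//; last exact: integrable_quad.
rewrite Rintegral_quad// RintegralD// RintegralZl// RintegralZl//; last exact: integrable_excess.
rewrite -/(excess mu p r s) -/c.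
by rewrite le_eqVlt; apply/orP; left; apply/eqP; ring.
Qed.

Section isometry_excess.
Variables (Phi : W -> W) (a b c d : R).
Hypothesis isoPhi : is_wasserstein_isometry Phi.
Hypotheses (ab : a ^+ 2 + b ^+ 2 = 1) (cd : c ^+ 2 + d ^+ 2 = 1)
  (acbd : a * c + b * d = 0).
Hypothesis means : forall mu : W, [/\ mean_a (Phi mu) = mean_a mu * a + mean_b mu * c,
     mean_b (Phi mu) = mean_a mu * b + mean_b mu * d,
     mean_c (Phi mu) = mean_c mu & mean_q (Phi mu) = mean_q mu].

Let norm_image p r : (p * a + r * c) ^+ 2 + (p * b + r * d) ^+ 2 = p ^+ 2 + r ^+ 2.
Proof.
transitivity (p ^+ 2 * (a ^+ 2 + b ^+ 2) + r ^+ 2 * (c ^+ 2 + d ^+ 2)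
  + 2 * p * r * (a * c + b * d)); first by ring.
by rewrite ab cd acbd; ring.
Qed.

Let two_point_image p r k (rho : W) :
  two_point (p * a + r * c) (p * b + r * d) k (Phi rho) <-> two_point p r k rho.
Proof.
have [ea eb ec eq] := means rho; rewrite /two_point ea eb ec eq norm_image.
split=> -[h1 h2 h3 h4]; split => //; last 2 first.
- by rewrite h1 h2; ring.
- by rewrite h1 h2; ring.
(* The transposed matrix recovers the means from their images. *)
- transitivity ((mean_a rho * a + mean_b rho * c) * a + (mean_a rho * b + mean_b rho * d) * b).
    transitivity (mean_a rho * (a ^+ 2 + b ^+ 2) + mean_b rho * (a * c + b * d)).
      by rewrite ab acbd; ring.
    by ring.
  rewrite h1 h2.
  transitivity (k * (p * (a ^+ 2 + b ^+ 2) + r * (a * c + b * d))); first by ring.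
  by rewrite ab acbd; ring.
- transitivity ((mean_a rho * a + mean_b rho * c) * c + (mean_a rho * b + mean_b rho * d) * d).
    transitivity (mean_a rho * (a * c + b * d) + mean_b rho * (c ^+ 2 + d ^+ 2)).
      by rewrite cd acbd; ring.
    by ring.
  rewrite h1 h2.
  transitivity (k * (p * (a * c + b * d) + r * (c ^+ 2 + d ^+ 2))); first by ring.
  by rewrite cd acbd; ring.
Qed.

(** With [t] as in the bounds above, [excess] is read off from the least value of the cost plus
    [k t] over two-point measures of planar mass [k]. [Phi] respects this family, its masses and the
    costs, so an optimal measure on one side competes on the other. *)
Lemma isometry_excess (mu : W) p r s :
  excess (Phi mu) (p * a + r * c) (p * b + r * d) s = excess mu p r s.
Proof.
have mu2 := finite_moment_wasserstein mu.
have Pmu2 := finite_moment_wasserstein (Phi mu).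
have [_ _ ec eq] := means mu.
apply/eqP; rewrite eq_le; apply/andP; split.
- have [rho' [k [tp le]]] := two_point_cost_attained (p * a + r * c) (p * b + r * d) s Pmu2.
  (* Surjectivity of [Phi] brings the optimal measure back to the side of [mu]. *)
  have [rho hrho] := isoPhi.2 rho'.
  have tp' : two_point (p * a + r * c) (p * b + r * d) k (Phi rho).
    by move: tp; rewrite /two_point /mean_a /mean_b /mean_c /mean_q
      !(Rintegral_same_measure _ hrho).
  have := two_point_cost_ge s mu2 (finite_moment_wasserstein rho) ((two_point_image _ _ _ _).1 tp').
  rewrite -(transport_cost_isometry isoPhi) (transport_cost_same_measurer _ hrho).
  by move=> /le_trans/(_ le); rewrite lee_fin norm_image ec eq; lra.
- have [rho [k [tp le]]] := two_point_cost_attained p r s mu2.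
  have tp' := (two_point_image _ _ _ _).2 tp.
  have := two_point_cost_ge s Pmu2 (finite_moment_wasserstein (Phi rho)) tp'.
  rewrite (transport_cost_isometry isoPhi).
  by move=> /le_trans/(_ le); rewrite lee_fin norm_image ec eq; lra.
Qed.

End isometry_excess.

End two_point_measures.

(** In [u^2 = 2 v^2] with nonzero terms, the exponent of 2 is even on one side and odd on the
    other. *)
Lemma sqrt2_irrational (R : rcfType) (u v : int) :
  u%:~R + v%:~R * Num.sqrt 2 = 0 :> R -> u = 0 /\ v = 0.
Proof.
move=> e; have e2 : (u * u = 2 * (v * v))%R.
  apply: (@intr_inj R); rewrite !intrM.
  have : (v%:~R * Num.sqrt 2 : R) ^+ 2 = u%:~R ^+ 2.
    by rewrite (_ : v%:~R * _ = - u%:~R) ?sqrrN//; lra.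
  by rewrite exprMn sqr_sqrtr ?ler0n// => h; rewrite -expr2 -h expr2; ring.
have : (`|u| * `|u| = 2 * (`|v| * `|v|))%N.
  by rewrite -!abszM e2 abszM.
have [->|v0] := eqVneq v 0.
  by rewrite absz0 mul0n muln0 => /eqP; rewrite muln_eq0 orbb absz_eq0 => /eqP ->.
have [->|u0] := eqVneq u 0.
  rewrite absz0 mul0n => /esym/eqP; rewrite !muln_eq0 /= orbb absz_eq0.
  by move=> /eqP ->.
move=> /(congr1 (logn 2)); rewrite !lognM ?muln_gt0 ?absz_gt0 ?u0 ?v0//.
by rewrite lognE/= !addnn => /(congr1 odd); rewrite /= !odd_double.
Qed.

(** * Determination of a measure by its excesses *)

Section law_determination.
Context {R : realType}.
Local Notation X := (plane_with_point R).
Implicit Types (mu nu : probability (borel X) R) (x y z : X) (p r s : R).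

Let upper p r s : set (borel X) := [set x : X | s < lin p r x].

Let measurable_upper p r s : measurable (upper p r s).
Proof.
rewrite (_ : upper p r s = lin p r @^-1` `]s, +oo[%classic).
  by rewrite -[_ @^-1` _]setTI; apply: measurable_lin.
by apply/seteqP; split => x; rewrite /upper /= in_itv /= andbT.
Qed.

Section one_measure.
Variables (mu : probability (borel X) R) (p r : R).
Hypothesis mu2 : finite_moment mu.

Let integrable_upper s : mu.-integrable setT (EFin \o (\1_(upper p r s) : borel X -> R)).
Proof. by apply: integrable_indic; exact: measurable_upper. Qed.

Let excess_diff s h : excess mu p r s - excess mu p r (s + h) =
  \int[mu]_x (Num.max 0 (lin p r x - s) - Num.max 0 (lin p r x - (s + h))).
Proof. by rewrite RintegralB//; exact: integrable_excess. Qed.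

Let integrable_diff s h : mu.-integrable setT (EFin \o
  ((fun x => Num.max 0 (lin p r x - s) - Num.max 0 (lin p r x - (s + h))) : borel X -> R)).
Proof.
have i1 := integrable_excess p r s mu2.
have i2 := integrable_excess p r (s + h) mu2.
exact: (integrableB measurableT i1 i2).
Qed.

(** The difference of the two positive parts is [h] where [lin > s + h], 0 where [lin <= s], and in
    between elsewhere. With [excess_le_tail] this squeezes the difference quotients of [excess]
    between two tails. *)
Lemma tail_le_excess s h : 0 < h ->
  h * fine (mu (upper p r (s + h))) <= excess mu p r s - excess mu p r (s + h).
Proof.
move=> h0; rewrite excess_diff -Rintegral_indic; last exact: measurable_upper.
rewrite -RintegralZl//; last exact: integrable_upper.
apply: le_Rintegral => //.
  by apply: integrable_scaleR; exact: integrable_upper.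
move=> x _; rewrite indicE; case: (boolP (x \in _)); rewrite ?inE /upper /= => hx.
  by rewrite !max_r; lra.
by rewrite mulr0 subr_ge0 ge_max !le_max lexx/=; apply/orP; right; lra.
Qed.

Lemma excess_le_tail s h : 0 < h ->
  excess mu p r s - excess mu p r (s + h) <= h * fine (mu (upper p r s)).
Proof.
move=> h0; rewrite excess_diff -Rintegral_indic; last exact: measurable_upper.
rewrite -RintegralZl//; last exact: integrable_upper.
apply: le_Rintegral => //.
  by apply: integrable_scaleR; exact: integrable_upper.
move=> x _; rewrite indicE; have [hx|hx] := ltP s (lin p r x).
  rewrite mem_set//= mulr1 (@max_r _ _ 0 (_ - s)) ?subr_ge0 ?(ltW hx)//.
  have : lin p r x - (s + h) <= Num.max 0 (lin p r x - (s + h)).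
    by rewrite le_max lexx orbT.
  by lra.
rewrite memNset /upper /= ?mulr0; last by apply/negP; rewrite -leNgt.
by rewrite !max_l; lra.
Qed.

End one_measure.

Section two_measures.
Variables mu nu : probability (borel X) R.
Hypotheses (mu2 : finite_moment mu) (nu2 : finite_moment nu).
Hypothesis eq_excess : forall p r s, excess mu p r s = excess nu p r s.

(** The tail of [mu] beyond [s + h] is at most a difference quotient of the common excess, hence at
    most the tail of [nu] beyond [s]. Continuity from below lets [h = 1 / (n + 1)] tend to 0. *)
Lemma tail_le p r s : (mu (upper p r s) <= nu (upper p r s))%E.
Proof.
pose U n := upper p r (s + n.+1%:R^-1).
have UE : upper p r s = \bigcup_n U n.
  apply/seteqP; split => [x /= sx|x [n _] /= sx].
    have [n] := @invS_lt R (lin p r x - s) (ltac:(by rewrite subr_gt0)).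
    by move=> hn; exists n => //; rewrite /U /upper /= -ltrBrDl.
  by apply: lt_trans sx; rewrite ltrDl invr_gt0.
have ndU : nondecreasing_seq U.
  move=> m n mn; apply/subsetPset => x; rewrite /U /upper /= => hx.
  by apply: le_lt_trans hx; rewrite lerD2l lef_pV2 ?posrE// ler_nat.
have cU : mu (U n) @[n --> \oo] --> mu (\bigcup_n U n).
  apply: nondecreasing_cvg_mu => //.
    by move=> n; exact: measurable_upper.
  by rewrite -UE; exact: measurable_upper.
rewrite [in leLHS]UE -(cvg_lim _ cU)//; apply: lime_le.
  by apply/cvg_ex; exists (mu (\bigcup_n U n)).
apply: nearW => n; have h0 : 0 < n.+1%:R^-1 :> R by rewrite invr_gt0.
have := tail_le_excess p r mu2 s h0; rewrite !eq_excess.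
move=> /le_trans/(_ (excess_le_tail p r nu2 s h0)); rewrite ler_pM2l// => h.
rewrite -(fineK (fin_num_measure mu _ (measurable_upper p r (s + n.+1%:R^-1)))).
by rewrite -(fineK (fin_num_measure nu _ (measurable_upper p r s))) lee_fin.
Qed.

End two_measures.

(** The tails agree, and open right half-lines are stable under intersection and generate the Borel
    sets. *)
Lemma eq_excess_law mu nu p r (B : set R) :
  finite_moment mu -> finite_moment nu ->
  (forall p r s, excess mu p r s = excess nu p r s) -> measurable B ->
  mu ((lin p r : borel X -> R) @^-1` B) = nu ((lin p r : borel X -> R) @^-1` B).
Proof.
move=> mu2 nu2 e mB.
pose m1 := push_prob mu (measurable_lin p r).
pose m2 := push_prob nu (measurable_lin p r).
suff : m1 B = m2 B by [].
refine (@measure_unique _ _ _ (@RGenOInfty.G R)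
  (fun n : nat => `]- n%:R, +oo[%classic) _ _ _ _ m1 m2 _ _ B mB).
- exact: RGenOInfty.measurableE.
- move=> _ _ [x ->] [y ->]; exists (Num.max x y).
  by apply/seteqP; split => z /=; rewrite !in_itv /= !andbT gt_max => /andP.
- by move=> n; exists (- n%:R).
- apply/seteqP; split => // x _; exists (Num.truncn `|x|).+1 => //=.
  rewrite in_itv/= andbT ltrNl (le_lt_trans (ler_norm _))// normrN.
  exact: truncnS_gt.
- move=> _ [x ->].
  have eU : (lin p r : borel X -> R) @^-1` `]x, +oo[%classic = upper p r x.
    by apply/seteqP; split => z; rewrite /upper /= in_itv /= andbT.
  have : mu (upper p r x) = nu (upper p r x).
    by apply/eqP; rewrite eq_le !tail_le.
  by rewrite -eU.
- by move=> k; rewrite ltey_eq; apply/orP; left; exact: fin_num_measure.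
Qed.

(** The point q has [ca = cb = 0] and belongs to every lattice. *)
Definition lattice (n : nat) : set X := [set x | exists i j : int,
  n%:R * ca x = i%:~R /\ n%:R * cb x = j%:~R].

Let integers : set R := range (fun i : int => i%:~R).

Let measurable_countable (A : set R) : countable A -> measurable A.
Proof. by move=> cA; apply: countable_measurable. Qed.

Let measurable_integers : measurable integers.
Proof. by apply: measurable_countable; exact: (sub_countable (card_image_le _ _)). Qed.

Let latticeE n : lattice n =
  (lin n%:R 0 : borel X -> R) @^-1` integers `&`
  (lin 0 n%:R : borel X -> R) @^-1` integers.
Proof.
(* [lin] carries the extra term [cc], an integer, which does not affect integrality. *)
have shift (t : R) (x : X) : integers (t + cc x) <-> integers t.
  have [e ->] : exists e : int, cc x = e%:~R.
    by case: x => [u|]; [exists 1|exists 0].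
  split=> -[i _ hi]; [exists (i - e) => //|exists (i + e) => //].
    by rewrite intrB hi; ring.
  by rewrite intrD hi.
have linE1 x : lin n%:R 0 x = n%:R * ca x + cc x by rewrite /lin; ring.
have linE2 x : lin 0 n%:R x = n%:R * cb x + cc x by rewrite /lin; ring.
apply/seteqP; split => [x [i [j [hi hj]]]|x [/=]].
  split=> /=; rewrite ?linE1 ?linE2; apply/shift.
    by exists i.
  by exists j.
by rewrite linE1 linE2 => /shift[i _ hi] /shift[j _ hj]; exists i, j.
Qed.

Lemma measurable_lattice n : measurable (lattice n : set (borel X)).
Proof.
rewrite latticeE; apply: measurableI; rewrite -[_ @^-1` _]setTI;
by apply: measurable_lin.
Qed.

(* A linear form with irrational slope separates the points of a lattice. *)
Lemma eq_excess_lattice mu nu n : (0 < n)%N ->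
  finite_moment mu -> finite_moment nu ->
  (forall p r s, excess mu p r s = excess nu p r s) -> nu (lattice n) = 1%E ->
  same_measure mu nu.
Proof.
move=> n0 mu2 nu2 e nuL S mS.
have mL := measurable_lattice n.
have pre1 (P : probability (borel X) R) (A B : set (borel X)) : measurable A ->
    measurable B -> A `<=` B -> P A = 1%E -> P B = 1%E.
  move=> mA mB AB PA; apply/eqP; rewrite eq_le probability_le1//= -PA.
  by apply: le_measure; rewrite ?inE.
have m1 : measurable ((lin n%:R 0 : borel X -> R) @^-1` integers).
  by rewrite -[_ @^-1` _]setTI; apply: measurable_lin.
have m2 : measurable ((lin 0 n%:R : borel X -> R) @^-1` integers).
  by rewrite -[_ @^-1` _]setTI; apply: measurable_lin.
have muL : mu (lattice n) = 1%E.
  rewrite latticeE probability_setI1//; rewrite (eq_excess_law _ _ mu2 nu2 e)//;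
    apply: (pre1 _ (lattice n)) => //; rewrite latticeE.
    exact: subIsetl.
  exact: subIsetr.
(* On the lattice this is [(2 i + cc) + 2 j sqrt 2]. Doubling makes [cc] the parity of the integer
   part, which tells q from the origin of the plane. *)
pose g : X -> R := lin (2 * n%:R) (2 * n%:R * Num.sqrt 2).
have gE x i j : n%:R * ca x = i%:~R -> n%:R * cb x = j%:~R ->
    g x = 2 * i%:~R + cc x + 2 * j%:~R * Num.sqrt 2.
  by move=> <- <-; rewrite /g /lin; ring.
have ccE x : exists k : int, cc x = k%:~R /\ (k = 0 \/ k = 1).
  by case: x => [u|]; [exists 1; split => //; right|exists 0; split => //; left].
have nn0 : n%:R != 0 :> R by rewrite pnatr_eq0 -lt0n.
have injg x y : lattice n x -> lattice n y -> g x = g y -> x = y.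
  move=> [i [j [hi hj]]] [i' [j' [hi' hj']]].
  rewrite (gE _ _ _ hi hj) (gE _ _ _ hi' hj').
  have [k [hk k01]] := ccE x; have [k' [hk' k01']] := ccE y.
  rewrite hk hk' => eg.
  have [] := @sqrt2_irrational R (2 * (i - i') + (k - k')) (2 * (j - j')).
    by rewrite !(intrD, intrM, intrB) /=; lra.
  move=> e1 e2.
  have ei : i = i' by case: k01 k01' e1 => -> [] ->; lia.
  have ej : j = j' by lia.
  have ek : k = k' by lia.
  apply: plane_inj; last by rewrite hk hk' ek.
  - by apply: (mulfI nn0); rewrite hi hi' ei.
  - by apply: (mulfI nn0); rewrite hj hj' ej.
(* [B] is countable, hence Borel; by injectivity [S] and the preimage of [B] agree on the
   lattice. *)
pose B := g @` (S `&` lattice n).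
have mB : measurable B.
  apply: measurable_countable.
  apply: (@sub_countable _ _ _ (range (fun q : int * int => q.1%:~R + q.2%:~R * Num.sqrt 2 : R))).
    apply: subset_card_le => _ [x [_ [i [j [hi hj]]]] <-].
    have [k [hk _]] := ccE x.
    exists (2 * i + k, 2 * j) => //=.
    by rewrite (gE _ _ _ hi hj) hk !(intrD, intrM).
  exact: (sub_countable (card_image_le _ _)).
have mgB : measurable ((g : borel X -> R) @^-1` B).
  by rewrite -[_ @^-1` _]setTI; apply: measurable_lin.
have SB : S `&` lattice n = (g : borel X -> R) @^-1` B `&` lattice n.
  apply/seteqP; split => [x [Sx Lx]|x [[y [Sy Ly] gy] Lx]].
    by split => //; exists x.
  by split => //; rewrite (injg _ _ Lx Ly (esym gy)).
rewrite -(probability_setI1 mS mL muL) -(probability_setI1 mS mL nuL) SB.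
by rewrite !probability_setI1//; exact: eq_excess_law.
Qed.

End law_determination.

(** * Comparison of measures on open sets *)

Section open_sets.
Context {R : realType} {X : pmetricType R}.
Implicit Types (P Q : probability (borel X) R) (U : set X) (e : R).

(** The erosion of [U]. The strict inequality makes it closed, and for open [U] it increases to [U]
    as [e] decreases to 0. *)
Definition inner U e := [set y | forall z, mdist y z < e -> U z].

Lemma closed_inner U e : 0 < e -> closed (inner U e).
Proof.
move=> e0; rewrite -[inner U e]setCK; apply: open_closedC.
have -> : ~` inner U e = \bigcup_(z in ~` U) ball z e.
  apply/seteqP; split => [y|y [z nUz]].
    move=> /existsNP[z /not_implyP[yz nUz]]; exists z => //.
    by rewrite ballEmdist/= metric_sym.
  by rewrite ballEmdist/= => zy h; apply: nUz; apply: h; rewrite metric_sym.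
apply: bigcup_open => z _; rewrite openE => y; rewrite ballEmdist/= => zy.
apply/nbhs_ballP; exists (e - mdist z y); first by rewrite /= subr_gt0.
move=> w; rewrite !ballEmdist/= => yw.
by rewrite (le_lt_trans (metric_triangle _ y _))// -ltrBrDl.
Qed.

Lemma measurable_inner U e : 0 < e -> measurable (inner U e : set (borel X)).
Proof. by move=> e0; apply: (@closed_borel R X); exact: closed_inner. Qed.

Lemma inner_sub U e : 0 < e -> inner U e `<=` U.
Proof. by move=> e0 y; apply; rewrite mdistxx. Qed.

(** Continuity from below along the sets [inner U (1 / (n + 1))]. *)
Lemma probability_open_le P U (b : \bar R) : open U ->
  (forall e, 0 < e -> (P (inner U e) <= b)%E) -> (P U <= b)%E.
Proof.
move=> oU Pb; pose V n : set (borel X) := inner U n.+1%:R^-1.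
have V0 n : 0 < n.+1%:R^-1 :> R by rewrite invr_gt0.
have UE : U = \bigcup_n V n.
  apply/seteqP; split => [x Ux|x [n _]]; last by exact: inner_sub.
  have /nbhs_ballP[e /= e0 eU] : nbhs x U by exact: open_nbhs_nbhs.
  have [n ne] := invS_lt e0; exists n => // z xz; apply: eU.
  by rewrite ballEmdist/= (lt_trans xz).
have ndV : nondecreasing_seq V.
  move=> m n mn; apply/subsetPset => x h z xz; apply: h; apply: lt_le_trans xz _.
  by rewrite lef_pV2 ?posrE// ler_nat.
have cV : P (V n) @[n --> \oo] --> P (\bigcup_n V n).
  apply: nondecreasing_cvg_mu => //; first by move=> n; exact: measurable_inner.
  by rewrite -UE; exact: open_borel.
rewrite UE -(cvg_lim _ cV)//; apply: lime_le.
  by apply/cvg_ex; exists (P (\bigcup_n V n)).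
by apply: nearW => n; exact: Pb.
Qed.

(** The inequality on the complement of a closed set reverses on the closed set. Applied to
    [inner U e], this yields equality on open sets, which are stable under intersection and
    generate. *)
Lemma same_measure_open_le P Q : (forall U, open U -> (P U <= Q U)%E) ->
  same_measure P Q.
Proof.
move=> PQ A mA.
refine (@measure_unique _ R (borel X) (@open X) (fun _ : nat => setT) erefl
  _ _ _ P Q _ _ A mA).
- by move=> U V; exact: openI.
- by move=> _; exact: openT.
- by apply/seteqP; split => // x _; exists 0%N.
- move=> U oU; apply/eqP; rewrite eq_le PQ//=.
  apply: probability_open_le => // e e0.
  have mI : measurable (inner U e : set (borel X)) by exact: measurable_inner.
  have cI : closed (inner U e) by exact: closed_inner.
  apply: (@le_trans _ _ (P (inner U e))); last first.
    apply: le_measure; rewrite ?inE//; [exact: open_borel|exact: inner_sub].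
  have := PQ _ (closed_openC cI).
  rewrite !probability_setC//.
  rewrite -(fineK (fin_num_measure P _ mI)) -(fineK (fin_num_measure Q _ mI)).
  by rewrite -!EFinB !lee_fin; lra.
- by move=> _; rewrite ltey_eq; apply/orP; left; exact: fin_num_measure.
Qed.

(* [inner U (e + e)] is at distance at least [e] from the complement of [inner U e]. *)
Lemma inner_transport_cost P Q U e : 0 < e ->
  ((e ^+ 2 * (fine (P (inner U (e + e))) - fine (Q (inner U e))))%:E
    <= transport_cost P Q)%E.
Proof.
move=> e0; have ee0 : 0 < e + e by rewrite addr_gt0.
have mI : measurable (inner U e : set (borel X)) by exact: measurable_inner.
have mI2 : measurable (inner U (e + e) : set (borel X)) by exact: measurable_inner.
have i1 : P.-integrable setT (EFin \o (\1_(inner U (e + e)) : borel X -> R)).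
  exact: integrable_indic.
have i2 : Q.-integrable setT (EFin \o (\1_(inner U e) : borel X -> R)).
  exact: integrable_indic.
apply: le_trans (@weak_duality _ _ P Q
  (fun x => e ^+ 2 * \1_(inner U (e + e)) x) (fun x => - e ^+ 2 * \1_(inner U e) x)
  setT setT measurableT (probability_setT P) measurableT (probability_setT Q)
  _ (integrable_scaleR _ i1) _ (integrable_scaleR _ i2) _).
- by rewrite !RintegralZl// !Rintegral_indic// lee_fin; lra.
- by apply: measurable_funM => //; exact: measurable_indic.
- by apply: measurable_funM => //; exact: measurable_indic.
- move=> y z _ _; rewrite !indicE.
  have e20 : 0 <= e ^+ 2 by exact: sqr_ge0.
  have d0 : 0 <= mdist y z ^+ 2 :> R by exact: sqr_ge0.
  case: (boolP (y \in _)); rewrite ?inE => hy; case: (boolP (z \in _)); rewrite ?inE => hz;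
    rewrite ?mulr1 ?mulr0 ?addr0 ?add0r//=; [by rewrite subrr| |lra].
  have /existsNP[w /not_implyP[zw nUw]] : ~ inner U e z.
    by move=> /mem_set; exact/negP.
  rewrite ler_sqr ?nnegrE ?mdist_ge0 ?(ltW e0)// leNgt; apply/negP => yz.
  apply: nUw; apply: hy.
  by rewrite (le_lt_trans (metric_triangle _ z _))// ltrD.
Qed.

End open_sets.

(** * Rounding to a lattice *)

Section lattice_approximation.
Context {R : realType}.
Local Notation X := (plane_with_point R).

Definition grid (n : nat) (t : R) : R := (Num.floor (n%:R * t))%:~R / n%:R.

Definition grid_point (n : nat) (x : X) : X :=
  if x is Some u then Some (pt (grid n (ca x)) (grid n (cb x))) else None.

Lemma measurable_grid n : measurable_fun setT (grid n).
Proof.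
have mfl : measurable_fun setT (fun t : R => (Num.floor t)%:~R : R).
  apply: (measurability _ (RGenOInfty.measurableE R)) => _ [_ [s ->] <-].
  rewrite setTI (_ : _ @^-1` _ = `[(Num.floor s + 1)%:~R, +oo[%classic)//.
  by apply/seteqP; split => t; rewrite /= !in_itv/= !andbT -floor_ge_int lezD1
    floor_lt_int.
apply: measurable_funM => //.
have mn : measurable_fun setT (fun t : R => n%:R * t).
  exact: measurable_funM.
by have := measurableT_comp mfl mn; exact.
Qed.

Lemma grid0 n : grid n 0 = 0.
Proof. by rewrite /grid mulr0 floor0 mul0r. Qed.

Lemma grid_close n t : (0 < n)%N -> (t - grid n t) ^+ 2 <= n%:R^-1 ^+ 2.
Proof.
move=> n0; have nR : 0 < n%:R :> R by rewrite ltr0n.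
have -> : t - grid n t = (n%:R * t - (Num.floor (n%:R * t))%:~R) / n%:R.
  by rewrite /grid; field; rewrite gt_eqF.
rewrite exprMn ler_piMl ?sqr_ge0//.
have := floor_le (n%:R * t); have := floorD1_gt (n%:R * t).
by rewrite intrD; nra.
Qed.

Lemma ca_grid n x : ca (grid_point n x) = grid n (ca x).
Proof. by case: x => [u|]; rewrite /grid_point ?ca_pt//= grid0. Qed.

Lemma cb_grid n x : cb (grid_point n x) = grid n (cb x).
Proof. by case: x => [u|]; rewrite /grid_point ?cb_pt//= grid0. Qed.

Lemma cc_grid n x : cc (grid_point n x) = cc x.
Proof. by case: x. Qed.

Lemma measurable_grid_point n :
  measurable_fun setT (grid_point n : borel X -> borel X).
Proof.
apply: measurable_to_plane.
- rewrite (_ : _ \o _ = grid n \o ca); last by apply/funext => x; exact: ca_grid.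
  by have := measurableT_comp (measurable_grid n) (@measurable_ca R); exact.
- rewrite (_ : _ \o _ = grid n \o cb); last by apply/funext => x; exact: cb_grid.
  by have := measurableT_comp (measurable_grid n) (@measurable_cb R); exact.
- rewrite (_ : _ \o _ = cc); last by apply/funext => x; exact: cc_grid.
  exact: measurable_cc.
Qed.

Lemma grid_point_lattice n x : (0 < n)%N -> lattice n (grid_point n x).
Proof.
move=> n0; have nR : n%:R != 0 :> R by rewrite pnatr_eq0 -lt0n.
exists (Num.floor (n%:R * ca x)), (Num.floor (n%:R * cb x)).
by rewrite ca_grid cb_grid /grid; split; field.
Qed.

Lemma grid_point_close n x : (0 < n)%N ->
  mdist x (grid_point n x) ^+ 2 <= 2 * n%:R^-1 ^+ 2.
Proof.
move=> n0; rewrite mdist_sqr ca_grid cb_grid cc_grid.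
by have := grid_close (ca x) n0; have := grid_close (cb x) n0; lra.
Qed.

End lattice_approximation.

(** * Orthogonal maps of the plane, extended by q *)

Section orthogonal_maps.
Context {R : realType}.
Local Notation X := (plane_with_point R).

(** Row vectors are multiplied by the matrix with rows [(a, b)] and [(c, d)]. Exchanging [b] and [c]
    transposes it, which inverts an orthogonal one. *)
Definition orthogonal_map (a b c d : R) (x : X) : X :=
  if x is Some u then Some (pt (ca x * a + cb x * c) (ca x * b + cb x * d)) else None.

Lemma ca_orthogonal a b c d x : ca (orthogonal_map a b c d x) = ca x * a + cb x * c.
Proof. by case: x => [u|]; rewrite /orthogonal_map ?ca_pt//=; ring. Qed.

Lemma cb_orthogonal a b c d x : cb (orthogonal_map a b c d x) = ca x * b + cb x * d.
Proof. by case: x => [u|]; rewrite /orthogonal_map ?cb_pt//=; ring. Qed.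

Lemma cc_orthogonal a b c d x : cc (orthogonal_map a b c d x) = cc x.
Proof. by case: x. Qed.

Lemma measurable_orthogonal a b c d :
  measurable_fun setT (orthogonal_map a b c d : borel X -> borel X).
Proof.
have m s t : measurable_fun setT (fun x : borel X => ca x * s + cb x * t).
  by apply: measurable_funD; apply: measurable_funM => //;
    [exact: measurable_ca|exact: measurable_cb].
apply: measurable_to_plane.
- rewrite (_ : _ \o _ = fun x => ca x * a + cb x * c)//.
  by apply/funext => x; exact: ca_orthogonal.
- rewrite (_ : _ \o _ = fun x => ca x * b + cb x * d)//.
  by apply/funext => x; exact: cb_orthogonal.
- rewrite (_ : _ \o _ = cc); last by apply/funext => x; exact: cc_orthogonal.
  exact: measurable_cc.
Qed.

Section orthogonality.
Variables a b c d : R.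
Hypotheses (ab : a ^+ 2 + b ^+ 2 = 1) (cd : c ^+ 2 + d ^+ 2 = 1)
  (acbd : a * c + b * d = 0).

Lemma orthogonal_mapK : cancel (orthogonal_map a b c d) (orthogonal_map a c b d).
Proof.
move=> x; apply: plane_inj; last by rewrite !cc_orthogonal.
- rewrite !ca_orthogonal cb_orthogonal.
  transitivity (ca x * (a ^+ 2 + b ^+ 2) + cb x * (a * c + b * d)); first by ring.
  by rewrite ab acbd; ring.
- rewrite cb_orthogonal ca_orthogonal cb_orthogonal.
  transitivity (ca x * (a * c + b * d) + cb x * (c ^+ 2 + d ^+ 2)); first by ring.
  by rewrite cd acbd; ring.
Qed.

Lemma mdist_orthogonal x y :
  mdist (orthogonal_map a b c d x) (orthogonal_map a b c d y) = mdist x y :> R.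
Proof.
apply: (@pexpIrn _ 2) => //; rewrite ?nnegrE ?mdist_ge0//.
rewrite !mdist_sqr !ca_orthogonal !cb_orthogonal !cc_orthogonal.
transitivity ((ca x - ca y) ^+ 2 * (a ^+ 2 + b ^+ 2)
  + (cb x - cb y) ^+ 2 * (c ^+ 2 + d ^+ 2)
  + 2 * (ca x - ca y) * (cb x - cb y) * (a * c + b * d) + (cc x - cc y) ^+ 2).
  by ring.
by rewrite ab cd acbd; ring.
Qed.

End orthogonality.

End orthogonal_maps.

(** * The isometry as a push-forward *)

Section rigidity.
Context {R : realType}.
Local Notation X := (plane_with_point R).
Local Notation W := (wasserstein_space X (2 : R)).
Variables (Phi : W -> W) (a b c d : R).
Hypothesis isoPhi : is_wasserstein_isometry Phi.
Hypotheses (ab : a ^+ 2 + b ^+ 2 = 1) (cd : c ^+ 2 + d ^+ 2 = 1)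
  (acbd : a * c + b * d = 0).
Hypothesis means : forall mu : W, [/\ mean_a (Phi mu) = mean_a mu * a + mean_b mu * c,
     mean_b (Phi mu) = mean_a mu * b + mean_b mu * d,
     mean_c (Phi mu) = mean_c mu & mean_q (Phi mu) = mean_q mu].

Let psi : borel X -> borel X := orthogonal_map a b c d.
Let psi' : borel X -> borel X := orthogonal_map a c b d.
Let mpsi : measurable_fun setT psi := measurable_orthogonal a b c d.
Let mpsi' : measurable_fun setT psi' := measurable_orthogonal a c b d.
Let psi'K : cancel psi' psi.
Proof.
have [h1 h2 h3] := orthonormal_transpose ab cd acbd.
exact: orthogonal_mapK.
Qed.
Let mdist_psi x y : mdist (psi x) (psi y) = mdist x y :> R.
Proof. exact: mdist_orthogonal. Qed.

(** Rounding is conjugated by [psi] so that the push-forward by [psi] of the rounded measure, rather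
    than the rounded measure, lives on the lattice, as [eq_excess_lattice] asks. *)
Let T (n : nat) : borel X -> borel X := psi' \o grid_point n \o psi.

Let mT n : measurable_fun setT (T n).
Proof.
have := measurableT_comp mpsi' (measurableT_comp (@measurable_grid_point R n) mpsi).
exact.
Qed.

Let psiT n x : psi (T n x) = grid_point n (psi x).
Proof. exact: psi'K. Qed.

Let T_close n x : (0 < n)%N -> mdist x (T n x) ^+ 2 <= 2 * n%:R^-1 ^+ 2.
Proof. by move=> n0; rewrite -mdist_psi psiT; exact: grid_point_close. Qed.

Let finite_moment_T (mu : W) n : (0 < n)%N -> finite_moment (push_prob mu (mT n)).
Proof.
move=> n0; have mu2 := finite_moment_wasserstein mu.
apply: integrable_push_prob; first exact: measurable_cq.
(* The constant comes from [cq (T n x) <= 2 cq x + 2 d(x, T n x)^2 <= 2 cq x + 4]. *)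
apply: (integrable_quad_bound mu2 (k := 6)).
  by have := measurableT_comp (@measurable_cq R) (mT n); exact.
move=> x; rewrite /= ger0_norm ?cq_ge0//.
have := T_close x n0; rewrite mdist_sqr /cq.
have : n%:R^-1 ^+ 2 <= 1 :> R by rewrite exprn_ile1 ?invr_ge0// invf_le1 ?ltr0n ?ler1n.
have := sqr_ge0 (cc x - cc (T n x)).
have := sqr_ge0 (ca (T n x) - 2 * ca x); have := sqr_ge0 (cb (T n x) - 2 * cb x).
nra.
Qed.

Let nu0 (mu : W) n (n0 : (0 < n)%N) : W := wasserstein_of (finite_moment_T mu n0).

(** [Phi] changes excesses by rotating the linear form, exactly as the push-forward by [psi] does,
    and this push-forward lives on a lattice. *)
Let Phi_nu0 (mu : W) n (n0 : (0 < n)%N) :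
  same_measure (Phi (nu0 mu n0)) (push_prob (nu0 mu n0) mpsi).
Proof.
have nu2 : finite_moment (nu0 mu n0) by exact: finite_moment_wasserstein.
have cq_psi x : cq (psi x) = cq x.
  have := mdist_psi None x; have -> : psi None = None by [].
  by move=> /(congr1 (fun t => t ^+ 2)); rewrite !mdist_None_sqr cc_orthogonal => /addIr.
have psi2 : finite_moment (push_prob (nu0 mu n0) mpsi).
  apply: integrable_push_prob; first exact: measurable_cq.
  by rewrite (_ : _ \o _ = cq)//; apply/funext => x; exact: cq_psi.
have [ac bd abcd] := orthonormal_transpose ab cd acbd.
apply: (eq_excess_lattice n0) => //; first exact: finite_moment_wasserstein.
  move=> p r s.
  (* The image of [(p, r)] under the transposed matrix, which the original matrix maps back to
     [(p, r)]. *)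
  pose p0 := p * a + r * b; pose r0 := p * c + r * d.
  have ep : p0 * a + r0 * c = p.
    transitivity (p * (a ^+ 2 + c ^+ 2) + r * (a * b + c * d)); first by rewrite /p0 /r0; ring.
    by rewrite ac abcd; ring.
  have er : p0 * b + r0 * d = r.
    transitivity (p * (a * b + c * d) + r * (b ^+ 2 + d ^+ 2)); first by rewrite /p0 /r0; ring.
    by rewrite bd abcd; ring.
  have linE x : lin p r (psi x) = lin p0 r0 x.
    by rewrite /lin ca_orthogonal cb_orthogonal cc_orthogonal /p0 /r0; ring.
  rewrite -[in LHS]ep -[in LHS]er (isometry_excess isoPhi ab cd acbd means).
  rewrite /excess [RHS]Rintegral_push_prob.
  - by apply: eq_Rintegral => x _; rewrite linE.
  - exact: measurable_excess.
  - rewrite (_ : _ \o _ = fun x => Num.max 0 (lin p0 r0 x - s)).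
      exact: integrable_excess.
    by apply/funext => x /=; rewrite linE.
change (mu (T n @^-1` (psi @^-1` lattice n)) = 1%E).
rewrite (_ : _ @^-1` _ = setT) ?probability_setT//.
by apply/seteqP; split => // x _; rewrite /= psiT; exact: grid_point_lattice.
Qed.

(** [Phi mu] is close to the image under [Phi] of the rounded measure, which is its push-forward by
    [psi]. Passing between the two loses at most [del] of mass from one erosion of [U] to the next,
    and undoing the rounding stays inside [U]. *)
Lemma isometry_eq_push (mu : W) : same_measure (Phi mu) (push_prob mu mpsi).
Proof.
apply: same_measure_open_le => U oU; apply: probability_open_le => // e2 e20.
pose e := e2 / 2; have e0 : 0 < e by rewrite divr_gt0.
have -> : e2 = e + e by rewrite /e -splitr.
set P := Phi mu; set Q := push_prob mu mpsi.
have ee0 : 0 < e + e by rewrite addr_gt0.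
have mI : measurable (inner U e : set (borel X)) by exact: measurable_inner.
have mI2 : measurable (inner U (e + e) : set (borel X)) by exact: measurable_inner.
have mU : measurable (U : set (borel X)) by exact: open_borel.
rewrite -(fineK (fin_num_measure P _ mI2)) -(fineK (fin_num_measure Q _ mU)) lee_fin.
apply/ler_addgt0Pr => del del0.
have eq0 : 0 < e ^+ 2 by rewrite exprn_gt0.
(* With [1 / n < eta], the first bound gives [n^-2 <= n^-1], the second keeps the rounding
   displacement below [e], and the third makes the cost at most [e^2 del]. *)
pose eta := Num.min 1 (Num.min (e ^+ 2 / 2) (e ^+ 2 * del / 2)).
have eta0 : 0 < eta by rewrite !lt_min ltr01 !divr_gt0// mulr_gt0.
have [m hm] := invS_lt eta0.
set n := m.+1 in hm; have n0 : (0 < n)%N by [].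
have i0 : 0 < n%:R^-1 :> R by rewrite invr_gt0 ltr0n.
move: hm; rewrite !lt_min => /andP[hm1 /andP[hm2 hm3]].
have sq : 2 * n%:R^-1 ^+ 2 <= 2 * n%:R^-1 :> R.
  by move: i0 hm1; move: (n%:R^-1) => t t0 t1; nra.
have Phi2 : (transport_cost P (push_prob (nu0 mu n0) mpsi) <= (2 * n%:R^-1 ^+ 2)%:E)%E.
  rewrite -(transport_cost_same_measurer _ (Phi_nu0 mu n0)).
  rewrite (transport_cost_isometry isoPhi).
  apply: le_trans (transport_cost_map _ _) _.
  have -> : ((2 * n%:R^-1 ^+ 2)%:E = \int[mu]_y (2 * n%:R^-1 ^+ 2 : R)%:E)%E.
    by rewrite integral_cst// [X in (_ * X)%E]probability_setT mule1.
  apply: ge0_le_integral => //.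
  - by move=> y _; rewrite lee_fin sqr_ge0.
  - apply/measurable_EFinP/measurable_funX.
    have := measurableT_comp measurable_mdist
      (measurable_to_plane_pair (@measurable_id _ (borel X) setT) (mT n)).
    exact.
  - by move=> y _; rewrite lee_fin; exact: T_close.
have := inner_transport_cost P (push_prob (nu0 mu n0) mpsi) U e0.
move=> /le_trans/(_ Phi2); rewrite lee_fin => le.
have Qle : fine (push_prob (nu0 mu n0) mpsi (inner U e)) <= fine (Q U).
  apply: fine_le; [exact: fin_num_measure|exact: fin_num_measure|].
  change (mu (T n @^-1` (psi @^-1` inner U e)) <= mu (psi @^-1` U))%E.
  apply: le_measure; rewrite ?inE.
  - have := measurableT_comp mpsi (mT n); rewrite /measurable_fun.
    by move=> /(_ measurableT _ mI); rewrite setTI.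
  - by rewrite -[_ @^-1` _]setTI; apply: mpsi.
  - move=> x; rewrite /= psiT; apply.
    rewrite metric_sym -ltr_sqr ?nnegrE ?mdist_ge0 ?(ltW e0)//.
    by have := grid_point_close (psi x) n0; lra.
have : e ^+ 2 * (fine (P (inner U (e + e))) - fine (push_prob (nu0 mu n0) mpsi (inner U e)))
    <= e ^+ 2 * del by lra.
by rewrite ler_pM2l//; lra.
Qed.

End rigidity.

Theorem theorem1p2 (R : realType) :
  isometrically_rigid (plane_with_point R) 2.
Proof.
move=> Phi isoPhi; have [a [b [c [d [ab cd acbd means]]]]] := isometry_means isoPhi.
exists (orthogonal_map a b c d); split; last first.
  move=> mu A mA; exact: (isometry_eq_push isoPhi ab cd acbd means mu mA).
split=> [x y|y]; first exact: mdist_orthogonal.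
have [ac bd abcd] := orthonormal_transpose ab cd acbd.
by exists (orthogonal_map a c b d y); exact: orthogonal_mapK.
Qed.
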